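(* Let $\alpha=(\alpha_0,\alpha_1,\dots,\alpha_{d+2})\in(\mathbb{C}\setminus\{0\})^{d+3}$. For $j\in\{1,2,\dots,d\}$ define $$\mathfrak{L}^z_j=\mathcal{L}_j(z_1,\dots,z_j;\alpha_0,\dots,\alpha_{j+1},z_{j+1}),$$ $$\mu_j=-\left(1-q^{-(n_1+n_2+\cdots+n_j)}\right)\left(1-\frac{\alpha_{j+1}^2}{\alpha_0^2}q^{n_1+n_2+\cdots+n_j-1}\right),$$ where $z_{d+1}=\alpha_{d+2}$ and $\mathcal{L}_j$ is the $q$-difference operator defined in the context (the last parameter of $\mathcal{L}_j$, playing the role of $\alpha_{j+2}$, is set equal to $z_{j+1}$). Then the multivariable Askey-Wilson polynomials $P_d(n;x;\alpha)$ satisfy $$\mathfrak{L}^z_j P_d(n;x;\alpha)=\mu_j P_d(n;x;\alpha)$$ for every $j\in\{1,2,\dots,d\}$ and every $n\in\mathbb{N}_0^d$, and the operators $\mathfrak{L}^z_j$ commute with each other, i.e. $\mathcal{A}_z=\mathbb{C}[\mathfrak{L}^z_1,\dots,\mathfrak{L}^z_d]$ is a commutative subalgebra of $\mathcal{D}_z$.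
   Context: Fix $q\in(0,1)$ and an integer $d\ge 1$. Put $(a;q)_n=\prod_{k=0}^{n-1}(1-aq^k)$, $(a_1,\dots,a_k;q)_n=\prod_{j}(a_j;q)_n$, and $${}_4\phi_3\left[\begin{matrix}a_1,a_2,a_3,a_4\\ b_1,b_2,b_3\end{matrix};q,q\right]=\sum_{m\ge0}\frac{(a_1,a_2,a_3,a_4;q)_m}{(q,b_1,b_2,b_3;q)_m}q^m.$$ Askey-Wilson polynomials: with $x=\frac12(z+z^{-1})$, $$p_n(x;a,b,c,e)=\frac{(ab,ac,ae;q)_n}{a^n}\,{}_4\phi_3\left[\begin{matrix}q^{-n},\,abce\,q^{n-1},\,az,\,az^{-1}\\ ab,\,ac,\,ae\end{matrix};q,q\right]$$ (after multiplying out the prefactor this is a polynomial expression in $x$, defined for all $a\neq0$, $b,c,e$). Multivariable Askey-Wilson polynomials: for $n=(n_1,\dots,n_d)\in\mathbb{N}_0^d$, $x_j=\frac12(z_j+z_j^{-1})$, $z_{d+1}=\alpha_{d+2}$, $N_k=n_1+\cdots+n_k$, $N_0=0$, $$P_d(n;x;\alpha)=\prod_{j=1}^{d}p_{n_j}\left(x_j;\alpha_jq^{N_{j-1}},\frac{\alpha_j}{\alpha_0^2}q^{N_{j-1}},\frac{\alpha_{j+1}}{\alpha_j}z_{j+1},\frac{\alpha_{j+1}}{\alpha_j}z_{j+1}^{-1}\right).$$ Operators: $E_{q,z_j}$ is the $q$-shift $z_j\mapsto qz_j$ acting on functions of $z=(z_1,\dots,z_d)$, $\triangle_{q,z_j}=E_{q,z_j}-1$,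 $\nabla_{q,z_j}=1-E_{q,z_j}^{-1}$; multi-index notation is used, e.g. $\triangle_{q,z}^{\nu}=\prod_j\triangle_{q,z_j}^{\nu_j}$, $|\nu|=\sum_j\nu_j$. $\mathcal{D}_z=\mathbb{C}(z_1,\dots,z_d)[E_{q,z_1}^{\pm1},\dots,E_{q,z_d}^{\pm1}]$ is the associative algebra of $q$-difference operators with rational coefficients in $z$. $I_j$ is the involution $z_j\mapsto z_j^{-1}$ (fixing $z_k$, $k\ne j$) on rational functions of $z$. The operator $\mathcal{L}_d=\mathcal{L}_d(z_1,\dots,z_d;\alpha_0,\dots,\alpha_{d+2})$ (defined for each $d\ge1$): for $\nu\in\{0,1\}^d\setminus\{0\}$ with nonzero components at positions $1\le i_1<\cdots<i_s\le d$, put $$A_\nu=(1-\alpha_{i_1}z_{i_1})\Big(1-\frac{\alpha_{i_1}z_{i_1}}{\alpha_0^2}\Big)\frac{\prod_{k=2}^s\Big(1-\frac{\alpha_{i_k}z_{i_k}z_{i_{k-1}}}{\alpha_{i_{k-1}}}\Big)\Big(1-\frac{q\alpha_{i_k}z_{i_k}z_{i_{k-1}}}{\alpha_{i_{k-1}}}\Big)}{\prod_{k=1}^s(1-z_{i_k}^2)(1-qz_{i_k}^2)}\Big(1-\frac{\alpha_{d+1}\alpha_{d+2}z_{i_s}}{\alpha_{i_s}}\Big)\Big(1-\frac{\alpha_{d+1}z_{i_s}}{\alpha_{i_s}\alpha_{d+2}}\Big).$$ For $\nu\in\mathbb{Z}^d$ write $\nu=\nu^+-\nu^-$ with $\nu_j^+=\max(\nu_j,0)$,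 $\nu_j^-=-\min(\nu_j,0)$. For $\nu\in\{-1,0,1\}^d\setminus\{0,1\}^d$ put $A_\nu=I^{\nu^-}(A_{\nu^++\nu^-})$, where $I^{\nu^-}$ is the composition of the $I_j$ with $\nu^-_j=1$. Then $$\mathcal{L}_d=\sum_{\nu\in\{-1,0,1\}^d\setminus\{0\}}(-1)^{|\nu^-|}A_\nu\,\triangle_{q,z}^{\nu^+}\nabla_{q,z}^{\nu^-}.$$ *)

(* Defs.v *)
From HB Require Import structures.
From mathcomp Require Import all_boot all_order all_algebra.
From mathcomp Require Import fraction complex reals.
From mathcomp Require Import mpoly ring.
Set Implicit Arguments.
Unset Strict Implicit.
Unset Printing Implicit Defensive.
Import Order.TTheory GRing.Theory Num.Theory.
Local Open Scope ring_scope.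
Local Open Scope complex_scope.

Section BasicHypergeometric.
Variables (K : fieldType) (q : K).

Definition qpoch (a : K) (n : nat) : K := \prod_(k < n) (1 - a * q ^+ k).

Definition phi43_term (a1 a2 a3 a4 b1 b2 b3 : K) (m : nat) : K :=
  qpoch a1 m * qpoch a2 m * qpoch a3 m * qpoch a4 m
  / (qpoch q m * qpoch b1 m * qpoch b2 m * qpoch b3 m) * q ^+ m.

(* p_n(x; a, b, c, e) as a function of z, where x = (z + z^-1) / 2.  The
   prefactor (ab, ac, ae; q)_n is multiplied into the terminating series through
   (t; q)_n / (t; q)_m = (t q^m; q)_(n - m), so that the formula also makes sense
   when ab, ac or ae is a nonpositive power of q; see askey_wilsonE. *)
Definition askey_wilson (n : nat) (z a b c e : K) : K :=
  a ^- n *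
  \sum_(m < n.+1)
    qpoch (q ^- n) m * qpoch (a * b * c * e * q ^ (n%:Z - 1)) m
    * qpoch (a * z) m * qpoch (a / z) m / qpoch q m * q ^+ m
    * (qpoch (a * b * q ^+ m) (n - m) * qpoch (a * c * q ^+ m) (n - m)
       * qpoch (a * e * q ^+ m) (n - m)).

Lemma qpoch_split (a : K) (m n : nat) :
  (m <= n)%N -> qpoch a n = qpoch a m * qpoch (a * q ^+ m) (n - m).
Proof.
move=> le_mn; rewrite /qpoch -[in LHS](subnKC le_mn) big_split_ord /=.
by congr (_ * _); apply: eq_bigr => i _; rewrite exprD mulrA.
Qed.

Lemma phi43_term_eq0 (n m : nat) (a2 a3 a4 b1 b2 b3 : K) :
  q != 0 -> (n < m)%N -> phi43_term (q ^- n) a2 a3 a4 b1 b2 b3 m = 0.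
Proof.
move=> q0 lt_nm; rewrite /phi43_term {1}/qpoch (bigD1 (Ordinal lt_nm)) //=.
by rewrite mulVf ?expf_neq0 // subrr !mul0r.
Qed.

(* The defining formula of p_n; by phi43_term_eq0 the sum is the whole series. *)
Lemma askey_wilsonE (n : nat) (z a b c e : K) :
  qpoch (a * b) n != 0 -> qpoch (a * c) n != 0 -> qpoch (a * e) n != 0 ->
  askey_wilson n z a b c e =
  qpoch (a * b) n * qpoch (a * c) n * qpoch (a * e) n / a ^+ n *
  \sum_(m < n.+1)
    phi43_term (q ^- n) (a * b * c * e * q ^ (n%:Z - 1)) (a * z) (a / z)
               (a * b) (a * c) (a * e) m.
Proof.
move=> b0 c0 e0; rewrite /askey_wilson [RHS]mulrAC [RHS]mulrC.
congr (_ * _); rewrite mulr_sumr; apply: eq_bigr => [[m /= lt_mn]] _.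
have le_mn : (m <= n)%N by [].
move: b0 c0 e0; rewrite !(qpoch_split _ le_mn) !mulf_eq0 !negb_or.
move=> /andP[b0 _] /andP[c0 _] /andP[e0 _].
by rewrite /phi43_term; have [->|y0] := eqVneq (qpoch q m) 0;
  [rewrite !(mul0r, invr0, mulr0) | field; rewrite b0 c0 e0].
Qed.

(* A_nu for nu in {0,1}^j whose support is the increasing list s = i_1 < ... < i_s
   of positions in 1..j (j plays the role of d in L_d). *)
Definition coefA (j : nat) (a z : nat -> K) (s : seq nat) : K :=
  let i1 := head 0%N s in let il := last 0%N s in
  (1 - a i1 * z i1) * (1 - a i1 * z i1 / a 0%N ^+ 2)
  * ((\prod_(p <- zip s (behead s))
        ((1 - a p.2 * z p.2 * z p.1 / a p.1)
         * (1 - q * a p.2 * z p.2 * z p.1 / a p.1)))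
     / (\prod_(i <- s) ((1 - z i ^+ 2) * (1 - q * z i ^+ 2))))
  * (1 - a j.+1 * a j.+2 * z il / a il)
  * (1 - a j.+1 * z il / (a il * a j.+2)).

End BasicHypergeometric.

Lemma frac_numden (T : idomainType) (x : {fraction T}) :
  FracField.tofrac \n_(repr x) = x * FracField.tofrac \d_(repr x).
Proof.
set n := \n_(repr x); set m := \d_(repr x).
have m0 : m != 0 by exact: denom_ratioP.
rewrite -[x]reprK; unlock FracField.tofrac.
rewrite -[RHS]FracField.pi_mul; apply/eqmodP.
rewrite /= FracField.equivfE /FracField.mulf !numden_Ratio ?oner_neq0 ?mulr1 //.
by rewrite mul1r mulrC.
Qed.

Section RationalFunctions.
Variables (F : fieldType) (d : nat).

(* The field F(z_1, ..., z_d). *)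
Definition ratfun : fieldType := {fraction {mpoly F[d]}}.

Definition cst (c : F) : ratfun := FracField.tofrac (c%:MP : {mpoly F[d]}).

(* z_k for 1 <= k <= d (variables are numbered from 1); 0 is a junk value. *)
Definition zvar (k : nat) : ratfun :=
  if insub k.-1 is Some i then FracField.tofrac ('X_(i : 'I_d) : {mpoly F[d]}) else 0.

(* Substitution of s i for the i-th variable; when the s i are algebraically
   independent it does not depend on the chosen numerator and denominator, see
   fsubst_div. *)
Definition fsubst (s : 'I_d -> ratfun) (f : ratfun) : ratfun :=
  mmap cst s \n_(repr f) / mmap cst s \d_(repr f).

Lemma cst_is_zmod_morphism : zmod_morphism cst.
Proof. by move=> x y; rewrite /cst mpolyCB rmorphB. Qed.
HB.instance Definition _ :=
  GRing.isZmodMorphism.Build F ratfun cst cst_is_zmod_morphism.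

Lemma cst_is_monoid_morphism : monoid_morphism cst.
Proof. by split=> [|x y]; rewrite /cst ?rmorph1 // mpolyCM rmorphM. Qed.
HB.instance Definition _ :=
  GRing.isMonoidMorphism.Build F ratfun cst cst_is_monoid_morphism.

Lemma fsubst_div (s : 'I_d -> ratfun) (p r : {mpoly F[d]}) :
  (forall u : {mpoly F[d]}, mmap cst s u = 0 -> u = 0) -> r != 0 ->
  fsubst s (FracField.tofrac p / FracField.tofrac r) = mmap cst s p / mmap cst s r.
Proof.
move=> s_inj r0; rewrite /fsubst; set f := (X in repr X).
have inj u : u != 0 -> mmap cst s u != 0.
  by apply: contra_neq => /s_inj.
have d0 : \d_(repr f) != 0 by exact: denom_ratioP.
apply/eqP; rewrite eqr_div ?inj // -!rmorphM /=; apply/eqP; congr (mmap cst s _).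
apply/eqP; rewrite -tofrac_eq !rmorphM /= frac_numden /f.
by rewrite mulrAC divfK ?tofrac_eq0.
Qed.

(* The q-shift z_k |-> c z_k. *)
Definition shift (c : F) (k : nat) : ratfun -> ratfun :=
  fsubst (fun i => if i.+1 == k then cst c * zvar i.+1 else zvar i.+1).

(* The involution I_k. *)
Definition zinv (k : nat) : ratfun -> ratfun :=
  fsubst (fun i => if i.+1 == k then (zvar i.+1)^-1 else zvar i.+1).

(* The smallest algebra of operators on F(z) (with composition as product)
   containing S. *)
Inductive genalg (S : (ratfun -> ratfun) -> Prop) :
    (ratfun -> ratfun) -> Prop :=
| genalg_gen A : S A -> genalg S A
| genalg_id : genalg S id
| genalg_scale c A : genalg S A -> genalg S (fun f => cst c * A f)
| genalg_add A B : genalg S A -> genalg S B -> genalg S (fun f => A f + B f)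
| genalg_comp A B : genalg S A -> genalg S B -> genalg S (A \o B)
| genalg_ext A B : A =1 B -> genalg S A -> genalg S B.

(* Composition of the operators T k, k in s. *)
Definition compose (T : nat -> ratfun -> ratfun) (s : seq nat) :
    ratfun -> ratfun :=
  foldr (fun k A => T k \o A) id s.

End RationalFunctions.

Arguments zvar {F d}.

Section SignVectors.
Variable j : nat.

(* An element of {-1,0,1}^j, where t : 'I_3 stands for the sign t - 1. *)
Definition signvec := {ffun 'I_j -> 'I_3}.

Definition sgnv (nu : signvec) (i : 'I_j) : int := (nu i : nat)%:Z - 1.

(* The positions (from 1, increasing) where nu is nonzero, 1, -1. *)
Definition supp (nu : signvec) : seq nat :=
  [seq i.+1 | i : 'I_j <- enum 'I_j & sgnv nu i != 0].
Definition pos (nu : signvec) : seq nat :=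
  [seq i.+1 | i : 'I_j <- enum 'I_j & 0 < sgnv nu i].
Definition neg (nu : signvec) : seq nat :=
  [seq i.+1 | i : 'I_j <- enum 'I_j & sgnv nu i < 0].

End SignVectors.

Section Operators.
Variables (F : fieldType) (q : F) (d : nat).
Local Notation K := (ratfun F d).

Definition triangle (k : nat) (f : K) : K := shift q k f - f.
Definition nabla (k : nat) (f : K) : K := f - shift q^-1 k f.

(* D_z = F(z_1, ..., z_d)[E_{q,z_1}^{+-1}, ..., E_{q,z_d}^{+-1}]. *)
Definition Dz : (K -> K) -> Prop :=
  genalg (fun A => (exists g : K, A = (fun f => g * f))
    \/ exists k, (1 <= k <= d)%N /\ (A = shift q k \/ A = shift q^-1 k)).

(* L_j(z_1, ..., z_j; a_0, ..., a_(j+2)), for j <= d. *)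
Definition AWop (j : nat) (a : nat -> K) (f : K) : K :=
  \sum_(nu : signvec j | supp nu != [::])
    (-1) ^+ size (neg nu)
    * compose (@zinv F d) (neg nu) (coefA (cst d q) j a zvar (supp nu))
    * compose triangle (pos nu) (compose nabla (neg nu) f).

End Operators.

Section MultivariableAskeyWilson.
Variables (R : realType) (q : R) (d : nat) (alpha : 'I_d.+3 -> R[i]).
Local Notation K := (ratfun R[i] d).
Local Notation qK := (cst d q%:C).

Definition par (k : nat) : K := cst d (alpha (inord k)).

(* z_1, ..., z_d, and z_(d+1) = alpha_(d+2). *)
Definition zext (k : nat) : K := if k == d.+1 then par d.+2 else zvar k.

Definition psum (n : 'I_d -> nat) (k : nat) : nat := \sum_(i < d | (i < k)%N) n i.

Definition multiAW (n : 'I_d -> nat) : K :=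
  \prod_(i < d)
    let j := i.+1 in let Q := qK ^+ psum n j.-1 in
    askey_wilson qK (n i) (zext j)
      (par j * Q) (par j / par 0 ^+ 2 * Q)
      (par j.+1 / par j * zext j.+1) (par j.+1 / par j / zext j.+1).

Definition frakL (j : nat) : K -> K :=
  AWop q%:C j (fun k => if k == j.+2 then zext j.+1 else par k).

Definition mu (n : 'I_d -> nat) (j : nat) : R[i] :=
  - (1 - q%:C ^- psum n j)
  * (1 - alpha (inord j.+1) ^+ 2 / alpha ord0 ^+ 2
         * q%:C ^ ((psum n j)%:Z - 1)).

(* A_z = C[L_1, ..., L_d]. *)
Definition Az : (K -> K) -> Prop :=
  genalg (fun A => exists j, (1 <= j <= d)%N /\ A = frakL j).

End MultivariableAskeyWilson.

(* Main.v *)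
From HB Require Import structures.
Require Import Defs.
From mathcomp Require Import all_boot all_order all_algebra.
From mathcomp Require Import fraction complex reals.
From mathcomp Require Import mpoly ring.
Set Implicit Arguments.
Unset Strict Implicit.
Unset Printing Implicit Defensive.
Import Order.TTheory GRing.Theory Num.Theory.
Local Open Scope ring_scope.
Local Open Scope complex_scope.

(* The product over a chain i_1 < ... < i_s in A_nu is a transfer-matrix product:
   each link depends on the previous position only through a quadratic polynomial
   in z_i / alpha_i. Hence L_j is a combination of the three moments a, b, c, the
   sums over all chains in 1..j weighted by (z_i / alpha_i)^r at the last position,
   r = 0, 1, 2. Passing from j to j + 1 is the same algebraic step for every j.
   The moments satisfy ab = q ba, bc = q cb, ac = q b^2 + S b + t and
   ca = q^-1 b^2 + (S/q) b + t, where S = 1 + alpha_0^-2 and t = 1 / (q alpha_0^2);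
   each step preserves these relations, and they imply that
   T0 = a - alpha_(j+1) (w + 1/w) b + alpha_(j+1)^2 c, which is L_j up to a
   constant when w = z_(j+1), commutes with the next moments. This gives
   commutativity. The same induction shows that the partial product of j
   Askey-Wilson polynomials is an eigenfunction of T0 and, after a shift of
   z_(j+1), of two further combinations: one step is the Askey-Wilson difference
   equation, respectively a contiguous form of it. *)

(** The relations survive a step because of a better basis. Write $z=z_{j+1}$, let $E$ be its shift,
    $M(z)$ the combination of moments that appends one link, and put $T_+=M(z)E$,
    $T_-=M(z^{-1})E^{-1}$. Then $T_0$ commutes with $T_\pm$, both products of $T_+$ and $T_-$ are
    quadratic polynomials in $T_0$, and all three new moments lie in the span of $T_+,T_-,T_0,1$
    with coefficients depending on $z$. Each relation thus amounts to nine identities of rational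
    functions in $z$. Operators are linear only over a field of scalars that shrinks from level to
    level. At level $j$ the variable $z_{j+1}$ still is a scalar: $T_0$ contains it as a parameter
    and does not shift it, so $T_0$ passes the coefficients of the new moments. The two further
    combinations in the eigenfunction induction are $T_\pm$. The Askey-Wilson equation alone does
    not close that induction, because shifting the next variable changes the last two parameters
    $c,e$ of the current factor into $qc,e/q$; the contiguous form brings them back. *)

Lemma subf_div (K : fieldType) (x y x' y' : K) : y != 0 -> y' != 0 ->
  x / y - x' / y' = (x * y' - x' * y) / (y * y').
Proof. by move=> y0 y0'; field; rewrite y0 y0'. Qed.

(** * Shifts and inversions of variables as ring morphisms of the field of rational functions *)

Section Substitution.
Variables (F : fieldType) (d : nat).
Local Notation K := (ratfun F d).
Local Notation tofrac := (@FracField.tofrac {mpoly F[d]}).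
Local Notation subst := (mmap (@cst F d)).

Lemma mpoly_ring_ind (P : {mpoly F[d]} -> Prop) :
  (forall c, P c%:MP) -> (forall i, P 'X_i) ->
  (forall u v, P u -> P v -> P (u + v)) -> (forall u v, P u -> P v -> P (u * v)) ->
  forall u, P u.
Proof.
move=> PC PX PD PM; apply: mpolyind => [|c m p _ _ Pp].
  by rewrite -mpolyC0.
apply: PD => //; rewrite -mul_mpolyC; apply: (PM); first exact: PC.
rewrite mpolyXE_id; apply: big_ind => [||i _]; [by rewrite -mpolyC1; exact: PC | exact: PM |].
by elim: (m i) => [|k IH]; [rewrite expr0 -mpolyC1; exact: PC | rewrite exprS; exact: PM].
Qed.

Lemma zvarE (i : 'I_d) : zvar i.+1 = tofrac 'X_i.
Proof. by rewrite /zvar /= valK. Qed.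

Lemma zvar_ord (k : nat) : (1 <= k <= d)%N -> exists i : 'I_d, k = i.+1.
Proof. by case: k => // k kd; exists (Ordinal kd). Qed.

Lemma zvar_neq0 (k : nat) : (1 <= k <= d)%N -> zvar k != 0 :> K.
Proof.
by case/zvar_ord=> i ->; rewrite zvarE tofrac_eq0 -msupp_eq0 msuppX.
Qed.

(* If s' maps the image of each variable back to that variable, up to a power
   of the common denominator Y, then s' inverts s on all polynomials. *)
Lemma subst_inj (s s' : 'I_d -> K) (Y : {mpoly F[d]}) (y' : K) :
  tofrac Y != 0 -> subst s' Y = y' ->
  (forall i, exists N p, s i * tofrac Y ^+ N = tofrac p
      /\ subst s' p = tofrac 'X_i * y' ^+ N) -> y' != 0 ->
  forall u : {mpoly F[d]}, subst s u = 0 -> u = 0.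
Proof.
move=> Y0 Yy' sX y0 u.
suff [N [p [Hp Hu]]] : exists N p, subst s u * tofrac Y ^+ N = tofrac p
      /\ subst s' p = tofrac u * y' ^+ N.
  move=> u0; move: Hp Hu; rewrite u0 mul0r => /esym/eqP; rewrite tofrac_eq0.
  move=> /eqP->; rewrite raddf0 => /esym/eqP.
  by rewrite mulf_eq0 (negPf (expf_neq0 _ y0)) orbF tofrac_eq0 => /eqP.
elim/mpoly_ring_ind: u => [c|i|u v [N [p [Hp Hu]]] [M [r [Hr Hv]]]|].
- by exists 0%N, c%:MP; rewrite !expr0 !mulr1 !mmapC.
- by have [N [p [H1 H2]]] := sX i; exists N, p; rewrite mmapX mmap1U.
- exists (N + M)%N, (p * Y ^+ M + r * Y ^+ N).
  rewrite !rmorphD !rmorphM !rmorphXn /= Yy' -Hp -Hr Hu Hv !exprD.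
  by split; ring.
move=> u v [N [p [Hp Hu]]] [M [r [Hr Hv]]].
exists (N + M)%N, (p * r); rewrite !rmorphM /= -Hp -Hr Hu Hv !exprD.
by split; ring.
Qed.

Lemma ratfun_frac (f : K) : exists p r : {mpoly F[d]}, r != 0 /\ f = tofrac p / tofrac r.
Proof.
exists \n_(repr f), \d_(repr f); have d0 : \d_(repr f) != 0 by exact: denom_ratioP.
by split=> //; rewrite frac_numden mulfK // tofrac_eq0.
Qed.

Section Fsubst.
Variable s : 'I_d -> K.
Hypothesis s_inj : forall u : {mpoly F[d]}, subst s u = 0 -> u = 0.

Lemma subst_neq0 (u : {mpoly F[d]}) : u != 0 -> subst s u != 0.
Proof. by apply: contra_neq => /s_inj. Qed.

Lemma fsubst_tofrac (p : {mpoly F[d]}) : fsubst s (tofrac p) = subst s p.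
Proof.
by rewrite -[tofrac p]divr1 -(rmorph1 tofrac) fsubst_div ?oner_neq0 // rmorph1 divr1.
Qed.

Lemma fsubst_zmod_morphism : zmod_morphism (fsubst s).
Proof.
move=> f g; have [p [r [r0 ->]]] := ratfun_frac f; have [p' [r' [r0' ->]]] := ratfun_frac g.
have e : tofrac p / tofrac r - tofrac p' / tofrac r'
    = tofrac (p * r' - p' * r) / tofrac (r * r').
  by rewrite rmorphB !rmorphM /= subf_div ?tofrac_eq0.
rewrite e !fsubst_div ?mulf_neq0 // rmorphB !rmorphM /=.
by apply/esym/subf_div; apply: subst_neq0.
Qed.

Lemma fsubst_monoid_morphism : monoid_morphism (fsubst s).
Proof.
split=> [|f g].
  by rewrite -[X in fsubst s X](rmorph1 tofrac) fsubst_tofrac rmorph1.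
have [p [r [r0 ->]]] := ratfun_frac f; have [p' [r' [r0' ->]]] := ratfun_frac g.
have e : tofrac p / tofrac r * (tofrac p' / tofrac r') = tofrac (p * p') / tofrac (r * r').
  by rewrite !rmorphM /= mulf_div.
by rewrite e !fsubst_div ?mulf_neq0 // !rmorphM /= mulf_div.
Qed.

Lemma fsubst_cst c : fsubst s (cst d c) = cst d c.
Proof. by rewrite {1}/cst fsubst_tofrac mmapC. Qed.

Lemma fsubst_zvar (i : 'I_d) : fsubst s (zvar i.+1) = s i.
Proof. by rewrite zvarE fsubst_tofrac mmapX mmap1U. Qed.
End Fsubst.

Lemma shift_subst_inj (c : F) (k : nat) : c != 0 ->
  forall u : {mpoly F[d]},
  subst (fun i => if i.+1 == k then cst d c * zvar i.+1 else zvar i.+1) u = 0 -> u = 0.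
Proof.
move=> c0; pose s' (i : 'I_d) : K := if i.+1 == k then cst d c^-1 * zvar i.+1 else zvar i.+1.
apply: (@subst_inj _ s' 1 1) => [||i|].
- by rewrite rmorph1 oner_neq0.
- by rewrite rmorph1.
- exists 0%N, (if i.+1 == k then c%:MP * 'X_i else 'X_i); rewrite !expr0 !mulr1.
  case: eqP => [ik|ik]; last by rewrite zvarE mmapX mmap1U /s' (introF eqP ik) zvarE.
  rewrite zvarE rmorphM /= rmorphM /= mmapC mmapX mmap1U /s' ik eqxx -ik zvarE mulrA.
  by rewrite -(rmorphM (@cst F d)) mulfV // rmorph1 mul1r.
exact: oner_neq0.
Qed.

(** Inversion undoes itself, but $z_k^{-1}$ is not a polynomial. The common denominator is therefore
    ['X_i0], with exponent 1 for the inverted variable and 0 for the others. For [k] outside [1..d]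
    the substitution is the identity. *)
Lemma zinv_subst_inj (k : nat) : forall u : {mpoly F[d]},
  subst (fun i => if i.+1 == k then (zvar i.+1)^-1 else zvar i.+1) u = 0 -> u = 0.
Proof.
case: (boolP (1 <= k <= d)%N) => [/zvar_ord[i0 ->]|kd]; last first.
  apply: (@subst_inj _ (fun i => zvar i.+1) 1 1) => [||i|].
  - by rewrite rmorph1 oner_neq0.
  - by rewrite rmorph1.
  - exists 0%N, 'X_i; rewrite !expr0 !mulr1 mmapX mmap1U -zvarE.
    by case: eqP => // ik; move: kd; rewrite -ik /= ltn_ord.
  exact: oner_neq0.
pose s' (i : 'I_d) : K := if i.+1 == i0.+1 then (zvar i.+1)^-1 else zvar i.+1.
have z0 : zvar i0.+1 != 0 :> K by apply: zvar_neq0; rewrite /= ltn_ord.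
apply: (@subst_inj _ s' 'X_i0 (zvar i0.+1)^-1) => [||i|].
- by rewrite -zvarE.
- by rewrite mmapX mmap1U /s' eqxx.
- rewrite -!zvarE; case: eqP => [[/ord_inj->]|ii].
    by exists 1%N, 1; rewrite !expr1 !rmorph1 mulVf // mulfV.
  by exists 0%N, 'X_i; rewrite !expr0 !mulr1 mmapX mmap1U /s' (introF eqP ii) -zvarE.
by rewrite invr_eq0.
Qed.

(* The value at c = 0 is irrelevant, and makes this a ring morphism for all c. *)
Definition shiftm (c : F) (k : nat) : K -> K := if c == 0 then id else shift c k.

Lemma shiftmE c k : c != 0 -> shift c k = shiftm c k.
Proof. by rewrite /shiftm; case: eqP. Qed.

Lemma shiftm_is_zmod_morphism c k : zmod_morphism (shiftm c k).
Proof.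
rewrite /shiftm; case: eqVneq => // c0.
exact: fsubst_zmod_morphism (shift_subst_inj c0).
Qed.
HB.instance Definition _ c k :=
  GRing.isZmodMorphism.Build K K (shiftm c k) (shiftm_is_zmod_morphism c k).
Lemma shiftm_is_monoid_morphism c k : monoid_morphism (shiftm c k).
Proof.
rewrite /shiftm; case: eqVneq => // c0.
exact: fsubst_monoid_morphism (shift_subst_inj c0).
Qed.
HB.instance Definition _ c k :=
  GRing.isMonoidMorphism.Build K K (shiftm c k) (shiftm_is_monoid_morphism c k).

Lemma shiftm_cst c k x : shiftm c k (cst d x) = cst d x.
Proof.
rewrite /shiftm; case: eqVneq => // c0.
exact: fsubst_cst (shift_subst_inj c0) _.
Qed.

Lemma shiftm_zvar c k : c != 0 -> (1 <= k <= d)%N ->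
  shiftm c k (zvar k) = cst d c * zvar k.
Proof.
move=> c0 /zvar_ord[i ->]; rewrite /shiftm (negPf c0) /shift.
by rewrite (fsubst_zvar (shift_subst_inj c0)) eqxx.
Qed.

Lemma shiftm_zvar_neq c k l : (1 <= l <= d)%N -> l != k -> shiftm c k (zvar l) = zvar l.
Proof.
move=> /zvar_ord[i ->] ik; rewrite /shiftm; case: eqVneq => // c0.
by rewrite /shift (fsubst_zvar (shift_subst_inj c0)) (negPf ik).
Qed.

HB.instance Definition _ k :=
  GRing.isZmodMorphism.Build K K (@zinv F d k) (fsubst_zmod_morphism (@zinv_subst_inj k)).
HB.instance Definition _ k :=
  GRing.isMonoidMorphism.Build K K (@zinv F d k) (fsubst_monoid_morphism (@zinv_subst_inj k)).

Lemma zinv_cst k (c : F) : zinv k (cst d c) = cst d c.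
Proof. exact: fsubst_cst (@zinv_subst_inj k) _. Qed.

Lemma zinv_zvar k l : (1 <= l <= d)%N ->
  zinv k (zvar l) = (if l == k then (zvar l)^-1 else zvar l) :> K.
Proof. by move=> /zvar_ord[i ->]; rewrite /zinv (fsubst_zvar (@zinv_subst_inj k)). Qed.

Lemma ratfun_rmorph_ext (f g : {rmorphism K -> K}) :
  (forall c, f (cst d c) = g (cst d c)) ->
  (forall k, (1 <= k <= d)%N -> f (zvar k) = g (zvar k)) -> f =1 g.
Proof.
move=> fgC fgX x; have [p [r [r0 ->]]] := ratfun_frac x.
suff e u : f (tofrac u) = g (tofrac u) by rewrite !fmorph_div !e.
elim/mpoly_ring_ind: u => [c|i|u v Hu Hv|u v Hu Hv].
- exact: fgC.
- by rewrite -zvarE fgX // /= ltn_ord.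
- by rewrite !rmorphD /= Hu Hv.
by rewrite !rmorphM /= Hu Hv.
Qed.

Lemma shiftmK c k : (1 <= k <= d)%N -> cancel (shiftm c k) (shiftm c^-1 k).
Proof.
move=> kd x; have [->|c0] := eqVneq c 0; first by rewrite /shiftm invr0 eqxx.
apply: (@ratfun_rmorph_ext (shiftm c^-1 k \o shiftm c k) idfun) => [a|l ld] /=.
  by rewrite !shiftm_cst.
have [->|lk] := eqVneq l k; last by rewrite !shiftm_zvar_neq.
rewrite shiftm_zvar // rmorphM /= shiftm_cst shiftm_zvar ?invr_eq0 // mulrA.
by rewrite -(rmorphM (@cst F d)) mulfV // rmorph1 mul1r.
Qed.

Lemma shiftmC c c' k l : k != l -> (1 <= k <= d)%N -> (1 <= l <= d)%N ->
  shiftm c k \o shiftm c' l =1 shiftm c' l \o shiftm c k.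
Proof.
move=> kl kd ld x; have [->|c0] := eqVneq c 0; first by rewrite /= /shiftm eqxx.
have [->|c0'] := eqVneq c' 0; first by rewrite /= /shiftm eqxx.
apply: (@ratfun_rmorph_ext (shiftm c k \o shiftm c' l) (shiftm c' l \o shiftm c k)) => [a|m md] /=.
  by rewrite !shiftm_cst.
have [->|ml] := eqVneq m l.
  rewrite shiftm_zvar // [X in _ = shiftm c' l X]shiftm_zvar_neq 1?eq_sym //.
  by rewrite rmorphM /= shiftm_cst shiftm_zvar // shiftm_zvar_neq 1?eq_sym.
have [->|mk] := eqVneq m k; last by rewrite !shiftm_zvar_neq.
by rewrite [X in shiftm c k X]shiftm_zvar_neq // shiftm_zvar // rmorphM /= shiftm_cst shiftm_zvar_neq.
Qed.

(** Source of the nonvanishing denominators $1-q^mz^2$ and $q^m-z^2$; it suffices to read off the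
    coefficient of $z_k^2$. *)
Lemma zvar_sqr_neq (a b : F) k : (1 <= k <= d)%N -> b != 0 ->
  cst d a - cst d b * zvar k ^+ 2 != 0.
Proof.
case/zvar_ord=> i -> b0; rewrite zvarE /cst -!rmorphXn -!rmorphM -rmorphB /= tofrac_eq0.
apply: contra_neq b0 => /(congr1 (fun p => p@_(U_(i) *+ 2))).
rewrite mcoeffB mcoeffCM mcoeffC mpolyXn mcoeffX eqxx mulr1 mcoeff0.
case: (_ =P _) => [/(congr1 (fun m : 'X_{1.. d} => m i))|_].
  by rewrite mulmnE mnm0E mnm1E eqxx.
by rewrite mulr0 sub0r => /eqP; rewrite oppr_eq0 => /eqP.
Qed.
End Substitution.


(** * The one-variable Askey-Wilson difference equation and its contiguous form *)

Section OneVariable.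
Variables (K : fieldType) (q : K).
Hypothesis q0 : q != 0.
Local Notation qpoch := (qpoch q).

Lemma qpoch0 a : qpoch a 0 = 1.
Proof. by rewrite /qpoch big_ord0. Qed.

Lemma qpochSr a n : qpoch a n.+1 = qpoch a n * (1 - a * q ^+ n).
Proof. by rewrite /qpoch big_ord_recr. Qed.

Lemma qpochSl a n : qpoch a n.+1 = (1 - a) * qpoch (a * q) n.
Proof.
rewrite /qpoch big_ord_recl expr0 mulr1; congr (_ * _).
by apply: eq_bigr => i _; rewrite /bump /= exprS mulrA.
Qed.

(** The basis in which the $_4\phi_3$ series expands and the Askey-Wilson operator is bidiagonal. *)
Definition awbase (a z : K) m := qpoch (a * z) m * qpoch (a / z) m.

Definition awcoef (a b c e z : K) :=
  (1 - a * z) * (1 - b * z) * (1 - c * z) * (1 - e * z) / ((1 - z ^+ 2) * (1 - q * z ^+ 2)).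

(** The Askey-Wilson operator. The values at $z$, $qz$ and $z/q$ are separate arguments, so that no
    shift operator is needed here; later [fp] and [fm] become images under the shift and its
    inverse. *)
Definition awdiff (a b c e z f fp fm : K) :=
  awcoef a b c e z * (fp - f) + awcoef a b c e z^-1 * (fm - f).

Lemma awdiff_base (a b c e z : K) m :
  z != 0 -> 1 - z ^+ 2 != 0 -> 1 - q * z ^+ 2 != 0 -> q - z ^+ 2 != 0 ->
  awdiff a b c e z (awbase a z m.+1) (awbase a (q * z) m.+1) (awbase a (z / q) m.+1) =
  - (1 - q ^- m.+1) * (1 - a * b * c * e * q ^+ m) * awbase a z m.+1
  - q ^- m.+1 * (1 - q ^+ m.+1) * (1 - a * b * q ^+ m) * (1 - a * c * q ^+ m)
    * (1 - a * e * q ^+ m) * awbase a z m.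
Proof.
move=> z0 z1 z2 z3.
rewrite /awdiff /awbase.
(* e1 and e2 use the factors 1 - a z and 1 - a / z of the coefficients to bring
   everything over awbase a z m, so that no division by them is needed. *)
have e1 : (1 - a * z) * qpoch (a * (q * z)) m = qpoch (a * z) m * (1 - a * z * q ^+ m).
  by rewrite -qpochSr qpochSl; congr (_ * qpoch _ _); ring.
have e2 : (1 - a / z) * qpoch (a / (z / q)) m = qpoch (a / z) m * (1 - a / z * q ^+ m).
  by rewrite -qpochSr qpochSl; congr (_ * qpoch _ _); field; rewrite q0 z0.
have e3 : qpoch (a / (q * z)) m.+1 = (1 - a / (q * z)) * qpoch (a / z) m.
  by rewrite qpochSl; congr (_ * qpoch _ _); field; rewrite q0 z0.
have e4 : qpoch (a * (z / q)) m.+1 = (1 - a * (z / q)) * qpoch (a * z) m.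
  by rewrite qpochSl; congr (_ * qpoch _ _); field; rewrite q0.
rewrite e3 e4 !qpochSr exprSr.
move: e1 e2; set X := qpoch (a * (q * z)) m; set Y := qpoch (a / (z / q)) m.
set U := qpoch (a * z) m; set V := qpoch (a / z) m; move=> e1 e2.
have Qm0 : q ^+ m != 0 by rewrite expf_neq0.
move: Qm0; set Q := q ^+ m => Q0.
rewrite /awcoef.
have -> : (1 - a * z) * (1 - b * z) * (1 - c * z) * (1 - e * z) /
    ((1 - z ^+ 2) * (1 - q * z ^+ 2)) *
    (X * (1 - a * (q * z) * Q) * ((1 - a / (q * z)) * V) - U * (1 - a * z * Q) * (V * (1 - a / z * Q)))
  = (1 - b * z) * (1 - c * z) * (1 - e * z) / ((1 - z ^+ 2) * (1 - q * z ^+ 2)) * V *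
    (U * (1 - a * z * Q) * (1 - a * (q * z) * Q) * (1 - a / (q * z)) 
      - (1 - a * z) * U * (1 - a * z * Q) * (1 - a / z * Q)).
  by rewrite -[in RHS]e1; ring.
have -> : (1 - a / z) * (1 - b / z) * (1 - c / z) * (1 - e / z) /
    ((1 - z^-1 ^+ 2) * (1 - q * z^-1 ^+ 2)) *
    ((1 - a * (z / q)) * U * (Y * (1 - a / (z / q) * Q)) - U * (1 - a * z * Q) * (V * (1 - a / z * Q)))
  = (1 - b / z) * (1 - c / z) * (1 - e / z) / ((1 - z^-1 ^+ 2) * (1 - q * z^-1 ^+ 2)) * U *
    (V * (1 - a / z * Q) * (1 - a / (z / q) * Q) * (1 - a * (z / q)) 
      - (1 - a / z) * V * (1 - a * z * Q) * (1 - a / z * Q)).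
  by rewrite -[in RHS]e2; ring.
have z1' : z ^+ 2 - 1 != 0 by rewrite -opprB oppr_eq0.
have z3' : z ^+ 2 - q != 0 by rewrite -opprB oppr_eq0.
by field; rewrite z0 q0 Q0 z1 z2 z1' z3'.
Qed.

Lemma awdiff_base0 (a b c e z z' z'' : K) :
  awdiff a b c e z (awbase a z 0) (awbase a z' 0) (awbase a z'' 0) = 0.
Proof. by rewrite /awdiff /awbase !qpoch0 !subrr !mulr0 addr0. Qed.

(** Comparison of coefficients for a bidiagonal operator: [lam] is the diagonal, [bet] the
    subdiagonal. The top coefficient receives nothing from above, hence its separate hypothesis. *)
Lemma sum_two_term (n : nat) (c D lam bet r f : nat -> K) :
  D 0%N = lam 0%N * f 0%N ->
  (forall m, D m.+1 = lam m.+1 * f m.+1 + bet m * f m) ->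
  (forall m, (m < n)%N -> c m * lam m + c m.+1 * bet m = r m) ->
  c n * lam n = r n ->
  \sum_(m < n.+1) c m * D m = \sum_(m < n.+1) r m * f m.
Proof.
move=> D0 DS crel cn.
suff H k : (k <= n)%N ->
    \sum_(m < k.+1) c m * D m = \sum_(m < k) r m * f m + c k * lam k * f k.
  by rewrite H // big_ord_recr /= cn.
elim: k => [|k IH] kn; first by rewrite big_ord1 big_ord0 add0r D0 mulrA.
by rewrite big_ord_recr /= IH 1?ltnW // big_ord_recr /= -crel // DS; ring.
Qed.

Hypothesis qn1 : forall n, 1 - q ^+ n.+1 != 0.

Lemma divq_expS x m : x / q * q ^+ m.+1 = x * q ^+ m.
Proof. by rewrite exprS mulrA divfK. Qed.

Definition awterm n (a b c e : K) m :=
  qpoch (q ^- n) m * qpoch (a * b * c * e / q * q ^+ n) m / qpoch q m * q ^+ m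
  * (qpoch (a * b * q ^+ m) (n - m) * qpoch (a * c * q ^+ m) (n - m)
     * qpoch (a * e * q ^+ m) (n - m)).

Lemma askey_wilson_base n z a b c e :
  askey_wilson q n z a b c e = a ^- n * \sum_(m < n.+1) awterm n a b c e m * awbase a z m.
Proof.
rewrite /askey_wilson; congr (_ * _); apply: eq_bigr => m _.
have -> : a * b * c * e * q ^ (n%:Z - 1) = a * b * c * e / q * q ^+ n.
  by rewrite expfzDr // exprN1 -exprnP; ring.
by rewrite /awterm /awbase; ring.
Qed.

Lemma qpoch_q_neq0 m : qpoch q m != 0.
Proof.
by elim: m => [|m IH]; rewrite ?qpoch0 ?oner_neq0 // qpochSr mulf_neq0 // -exprS.
Qed.

Lemma awdiff_sum n (a b c e : K) (u : nat -> K) (g : K) (f fp fm : nat -> K) :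
  awdiff a b c e g (\sum_(m < n) u m * f m) (\sum_(m < n) u m * fp m) (\sum_(m < n) u m * fm m)
  = \sum_(m < n) u m * awdiff a b c e g (f m) (fp m) (fm m).
Proof.
rewrite /awdiff -!sumrB !mulr_sumr -big_split /=.
by apply: eq_bigr => m _; ring.
Qed.

Lemma awdiffZ (a b c e z k f fp fm : K) :
  awdiff a b c e z (k * f) (k * fp) (k * fm) = k * awdiff a b c e z f fp fm.
Proof. by rewrite /awdiff; ring. Qed.

Section Identities.
Variables (n : nat) (z a b c e : K).
Hypotheses (z0 : z != 0) (z1 : 1 - z ^+ 2 != 0) (z2 : 1 - q * z ^+ 2 != 0)
  (z3 : q - z ^+ 2 != 0).

Lemma askey_wilson_eq : let p x := askey_wilson q n x a b c e in
  awdiff a b c e z (p z) (p (q * z)) (p (z / q))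
  = - (1 - q ^- n) * (1 - a * b * c * e / q * q ^+ n) * p z.
Proof.
rewrite /= !askey_wilson_base awdiffZ awdiff_sum mulrCA; congr (_ * _).
rewrite mulr_sumr.
pose lam m := - (1 - q ^- m) * (1 - a * b * c * e / q * q ^+ m).
pose bet m := - (q ^- m.+1 * (1 - q ^+ m.+1) * (1 - a * b * q ^+ m) * (1 - a * c * q ^+ m)
  * (1 - a * e * q ^+ m)).
apply: etrans (@sum_two_term n (awterm n a b c e)
  (fun m => awdiff a b c e z (awbase a z m) (awbase a (q * z) m) (awbase a (z / q) m))
  lam bet (fun m => lam n * awterm n a b c e m) (awbase a z) _ _ _ _) _.
- by rewrite awdiff_base0 /lam expr0 invr1 subrr oppr0 !mul0r.
- by move=> m; rewrite awdiff_base // /lam /bet divq_expS !mulNr.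
- move=> m lt_mn; rewrite /awterm /lam /bet.
  have -> : (n - m = (n - m.+1).+1)%N by rewrite subnSK.
  (* One factor is split off each q-Pochhammer symbol whose length differs between the terms $m$ and
     $m+1$. The remaining symbols agree and become opaque, and only $q^m$ and $q^{n-m-1}$ are left
     as powers. *)
  have Qn : q ^+ n = q * q ^+ m * q ^+ (n - m.+1).
    by rewrite -exprS -exprD subnKC.
  have e3 x : x * q ^+ m.+1 = x * q ^+ m * q by rewrite exprSr mulrA.
  have := qpoch_q_neq0 m; have := qn1 m; have := expf_neq0 m q0; have := expf_neq0 (n - m.+1) q0.
  rewrite ![qpoch _ (n - m.+1).+1]qpochSl !qpochSr.
  rewrite !e3; move: (qpoch (q ^- n) m) => x1; move: (qpoch _ m) => x2.
  move: (qpoch q m) (qpoch _ (n - m.+1)) (qpoch _ (n - m.+1)) (qpoch _ (n - m.+1)) => x3 x4 x5 x6.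
  rewrite Qn exprS; move: (q ^+ m) (q ^+ (n - m.+1)) => Q S S0 Q0 qQ x30.
  by field; rewrite q0 Q0 S0 x30 qQ.
- by rewrite mulrC.
by apply: eq_bigr => m _; rewrite [RHS]mulrA.
Qed.
(** With parameters $a,b,c,qc$ the diagonal entries on the basis are $-(1-q^{-m})(1-abc^2q^m)$.
    Adding $(1-ac)(1-bc)$ turns them into $q^{-m}(1-acq^m)(1-bcq^m)$, and the value at $m=n$ is the
    factor on the right. *)
Lemma askey_wilson_eq1 : let P x := askey_wilson q n x a b (q * c) (e / q) in
  (1 - a * c) * (1 - b * c) * P z + awdiff a b c (q * c) z (P z) (P (q * z)) (P (z / q))
  = q ^- n * (1 - a * c * q ^+ n) * (1 - b * c * q ^+ n) * askey_wilson q n z a b c e.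
Proof.
rewrite /= !askey_wilson_base awdiffZ awdiff_sum [LHS]addrC [(1 - a * c) * _ * _]mulrCA -mulrDr.
rewrite [RHS]mulrCA; congr (_ * _).
rewrite [in RHS]mulr_sumr [X in _ + X]mulr_sumr -big_split /=.
pose lam m := (1 - a * c) * (1 - b * c) - (1 - q ^- m) * (1 - a * b * c * (q * c) / q * q ^+ m).
pose bet m := - (q ^- m.+1 * (1 - q ^+ m.+1) * (1 - a * b * q ^+ m) * (1 - a * c * q ^+ m)
  * (1 - a * (q * c) * q ^+ m)).
pose g := q ^- n * (1 - a * c * q ^+ n) * (1 - b * c * q ^+ n).
apply: etrans (etrans _ (@sum_two_term n (awterm n a b (q * c) (e / q))
  (fun m => awdiff a b c (q * c) z (awbase a z m) (awbase a (q * z) m) (awbase a (z / q) m)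
     + (1 - a * c) * (1 - b * c) * awbase a z m)
  lam bet (fun m => g * awterm n a b c e m) (awbase a z) _ _ _ _)) _.
- by apply: eq_bigr => m _; rewrite [RHS]mulrDr [in RHS]mulrCA.
- by rewrite awdiff_base0 /lam expr0 invr1 subrr !mul0r subr0 add0r.
- by move=> m; rewrite awdiff_base // /lam /bet divq_expS; ring.
- move=> m lt_mn; rewrite /awterm /lam /bet /g.
  have -> : (n - m = (n - m.+1).+1)%N by rewrite subnSK.
  have Qn : q ^+ n = q * q ^+ m * q ^+ (n - m.+1).
    by rewrite -exprS -exprD subnKC.
  have e3 x : x * q ^+ m.+1 = x * q ^+ m * q by rewrite exprSr mulrA.
  have := qpoch_q_neq0 m; have := qn1 m; have := expf_neq0 m q0; have := expf_neq0 (n - m.+1) q0.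
  have ec : a * (q * c) * q ^+ m = a * c * q ^+ m * q by ring.
  have ee : a * (e / q) * q ^+ m * q = a * e * q ^+ m by field.
  rewrite ![qpoch (a * b * _) (n - m.+1).+1]qpochSl [qpoch (a * c * q ^+ m) (n - m.+1).+1]qpochSl.
  rewrite [qpoch (a * (e / q) * q ^+ m) (n - m.+1).+1]qpochSl.
  rewrite [qpoch (a * (q * c) * _) (n - m.+1).+1]qpochSr [qpoch (a * e * q ^+ m) (n - m.+1).+1]qpochSr.
  rewrite !e3 ee ec [qpoch (q ^- n) m.+1]qpochSr [qpoch q m.+1]qpochSr [qpoch _ m.+1]qpochSr.
  have -> : a * b * (q * c) * (e / q) = a * b * c * e by field.
  (* Replacing $c$ by $qc$ leaves two symbols of the same length, starting at $acq^{m+1}$ and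
     $acq^{m+2}$; they differ by one factor at each end. *)
  have : qpoch (a * c * q ^+ m * q * q) (n - m.+1) * (1 - a * c * q ^+ m * q)
      = qpoch (a * c * q ^+ m * q) (n - m.+1) * (1 - a * c * q ^+ m * q * q ^+ (n - m.+1)).
    by rewrite -qpochSr qpochSl mulrC.
  move: (qpoch (q ^- n) m) => x1; move: (qpoch (_ / q * _) m) => x2.
  move: (qpoch q m) (qpoch _ (n - m.+1)) (qpoch _ (n - m.+1)) (qpoch _ (n - m.+1))
    (qpoch _ (n - m.+1)) => x3 x4 x5 x6 x7.
  rewrite Qn exprS; move: (q ^+ m) (q ^+ (n - m.+1)) => Q S H S0 Q0 qQ x30; rewrite -H.
  apply: etrans (_ : _ = (q * Q * S)^-1 * (1 - b * c * (q * Q * S)) *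
    (x1 * x2 / x3 * Q * ((1 - a * b * Q) * x5 * (1 - a * c * Q) *
     (x4 * (1 - a * e * Q * S)))) * (x6 * (1 - a * c * Q * q * S))) _; last by ring.
  by rewrite -H; field; rewrite q0 Q0 S0 x30 qQ.
- have e3 : a * (q * c) * q ^+ n = a * c * q ^+ n * q by ring.
rewrite /lam /g /awterm !subnn !qpoch0.
have -> : a * b * (q * c) * (e / q) = a * b * c * e by field.
move: (expf_neq0 n q0) (qpoch_q_neq0 n); move: (qpoch _ n) (qpoch _ n) (qpoch _ n) => x1 x2 x3.
by move: (q ^+ n) => Q Q0 x0; field; rewrite x0 q0 Q0.
by apply: eq_bigr => m _; rewrite [RHS]mulrA.
Qed.
End Identities.
End OneVariable.

Lemma rmorph_qpoch (K : fieldType) (q : K) (E : {rmorphism K -> K}) a n :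
  E q = q -> E (qpoch q a n) = qpoch q (E a) n.
Proof.
move=> Eq; rewrite /qpoch rmorph_prod; apply: eq_bigr => k _.
by rewrite rmorphB rmorphM rmorphXn rmorph1 /= Eq.
Qed.

Lemma rmorph_askey_wilson (K : fieldType) (q : K) (E : {rmorphism K -> K}) n z a b c e :
  E q = q -> E (askey_wilson q n z a b c e) = askey_wilson q n (E z) (E a) (E b) (E c) (E e).
Proof.
move=> Eq; rewrite /askey_wilson rmorphM fmorphV rmorphXn rmorph_sum; congr (_ * _).
apply: eq_bigr => m _.
by rewrite !(rmorphM, fmorphV, rmorphXn) /= !rmorph_qpoch // !(rmorphM, fmorphV, rmorphXn, fmorphXz) /= Eq.
Qed.

Lemma rmorph_askey_wilson_eq (K : fieldType) (q : K) (E : {rmorphism K -> K}) n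
    z a b c e z' a' b' c' e' :
  E q = q -> E z = z' -> E a = a' -> E b = b' -> E c = c' -> E e = e' ->
  E (askey_wilson q n z a b c e) = askey_wilson q n z' a' b' c' e'.
Proof. by move=> Eq <- <- <- <- <-; rewrite rmorph_askey_wilson. Qed.

(** Inverting the next variable exchanges the last two parameters of a factor. This symmetry lets
    the backward shift be treated by the statement for the forward one. *)
Lemma askey_wilson_swap (K : fieldType) (q : K) n z a b c e :
  askey_wilson q n z a b c e = askey_wilson q n z a b e c.
Proof.
rewrite /askey_wilson; congr (_ * _); apply: eq_bigr => m _; congr (_ * _).
  by rewrite [a * b * c * e]mulrAC.
by rewrite mulrAC.
Qed.


Lemma rmorph_op4 (K : fieldType) (E : {rmorphism K -> K}) w x y u f1 f2 f3 f4 :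
  E (w * f1 + x * f2 + y * f3 + u * f4) = E w * E f1 + E x * E f2 + E y * E f3 + E u * E f4.
Proof. by rewrite !rmorphD !rmorphM. Qed.

(** * Operators linear over a field of scalars, and the relations between three moments *)

Section Triples.
Variables (K : fieldType) (q S t : K) (Sc : K -> Prop).

(** The scalars form a subfield given by a predicate, since it changes with the level while the
    ambient field [K] stays fixed. *)
Record scalars_ok : Prop := ScalarsOk {
  sc1 : Sc 1;
  scB : forall x y, Sc x -> Sc y -> Sc (x - y);
  scM : forall x y, Sc x -> Sc y -> Sc (x * y);
  scV : forall x, Sc x -> Sc x^-1 }.

Record slinear (A : K -> K) : Prop := Slinear {
  slinD : forall f g, A (f + g) = A f + A g;
  slinZ : forall x f, Sc x -> A (x * f) = x * A f }.

Record awtriple (a b c : K -> K) : Prop := AWTriple {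
  trA : slinear a; trB : slinear b; trC : slinear c;
  trAB : forall f, a (b f) = q * b (a f);
  trBC : forall f, b (c f) = q * c (b f);
  trAC : forall f, a (c f) = q * b (b f) + S * b f + t * f;
  trCA : forall f, c (a f) = q^-1 * b (b f) + S / q * b f + t * f }.

Hypothesis Sok : scalars_ok.

Lemma sc0 : Sc 0. Proof. by rewrite -(subrr 1); apply: (scB Sok); exact: (sc1 Sok). Qed.
Lemma scN x : Sc x -> Sc (- x). Proof. by rewrite -sub0r; apply: (scB Sok); exact: sc0. Qed.
Lemma scD x y : Sc x -> Sc y -> Sc (x + y).
Proof. by move=> Hx Hy; rewrite -[y]opprK; apply: (scB Sok) => //; apply: scN. Qed.
Lemma scX x n : Sc x -> Sc (x ^+ n).
Proof.
by move=> Hx; elim: n => [|n IH]; [exact: (sc1 Sok) | rewrite exprS; apply: (scM Sok)].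
Qed.

Lemma slin_op4 A w x y u f1 f2 f3 f4 : slinear A -> Sc w -> Sc x -> Sc y -> Sc u ->
  A (w * f1 + x * f2 + y * f3 + u * f4) = w * A f1 + x * A f2 + y * A f3 + u * A f4.
Proof. by move=> [AD AZ] *; rewrite !AD !AZ. Qed.

End Triples.

Ltac sc_tac ok :=
  repeat first [ assumption | exact: (sc1 ok) | exact: (sc0 ok)
    | apply: (scN ok) | apply: (scD ok) | apply: (scM ok) | apply: (scV ok) | apply: (scX ok)
    ].

(** * Algebra generated by the moments and the shift of one new variable *)

Section Step.
Variables (K : fieldType) (q S t : K) (Sc : K -> Prop) (a b c : K -> K).
Hypotheses (ok : scalars_ok Sc) (abc : awtriple q S t Sc a b c).
Hypotheses (q0 : q != 0) (Sq : Sc q) (SS : Sc S).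

Definition abcop (x1 x2 x3 x4 : K) (f : K) := x1 * a f + x2 * b f + x3 * c f + x4 * f.

(** Normal ordering: the relations reduce every quadratic product to $aa$, $ba$, $bb$, $cb$, $cc$
    and lower terms. Only the inner coefficients have to pass an operator, so only they need to be
    scalars. *)
Lemma abcop_comp x1 x2 x3 x4 y1 y2 y3 y4 f :
  Sc y1 -> Sc y2 -> Sc y3 -> Sc y4 ->
  abcop x1 x2 x3 x4 (abcop y1 y2 y3 y4 f) =
  x1 * y1 * a (a f) + (q * x1 * y2 + x2 * y1) * b (a f)
  + (q * x1 * y3 + x2 * y2 + q^-1 * x3 * y1) * b (b f)
  + (q * x2 * y3 + x3 * y2) * c (b f) + x3 * y3 * c (c f)
  + (x1 * y4 + x4 * y1) * a f + (S * x1 * y3 + x2 * y4 + S / q * x3 * y1 + x4 * y2) * b f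
  + (x3 * y4 + x4 * y3) * c f + (t * x1 * y3 + t * x3 * y1 + x4 * y4) * f.
Proof.
case: abc => Ta Tb Tc Tab Tbc Tac Tca ? ? ? ?; rewrite /abcop.
rewrite (slin_op4 _ _ _ _ Ta) // (slin_op4 _ _ _ _ Tb) // (slin_op4 _ _ _ _ Tc) //.
rewrite Tab Tbc Tac Tca; ring.
Qed.

Variables (al : K).
Hypotheses (al0 : al != 0) (Sal : Sc al).

(* The expansion of the sum over chains of the weight of one more link,
   (1 - al z u) (1 - q al z u) with u = z_i / alpha_i at the last position i; the
   term with S corrects the contribution of the empty chain. *)
Definition stepM z := abcop 1 (- al * z * (1 + q)) (q * al ^+ 2 * z ^+ 2) (- al * z * S).
Definition stepT0 z := abcop 1 (- al * (z + z^-1)) (al ^+ 2) 0.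

(** The argument $qz$ on the right is what the shift makes of $z$, so this becomes commutation of
    [stepT0 z] with [stepTp]. In the same way the argument $(qz)^{-1}$ in [stepM_M] is the shifted
    $z^{-1}$ of [stepTm]. *)
Lemma stepM_T0 z h : z != 0 -> Sc z ->
  stepT0 z (stepM z h) = stepM z (stepT0 (q * z) h).
Proof.
move=> z0 Sz; rewrite /stepM /stepT0 !abcop_comp; try by sc_tac ok.
by field; rewrite z0 q0.
Qed.

Lemma stepM_M z h : z != 0 -> Sc z ->
  stepM z (stepM (q * z)^-1 h) = stepT0 z (stepT0 z h)
   - al * S * (z + (q * z)^-1) * stepT0 z h
   + al ^+ 2 * (t * q * z ^+ 2 + t / (q * z ^+ 2) + S ^+ 2 / q - 2 * t) * h.
Proof.
move=> z0 Sz; rewrite /stepM /stepT0 !abcop_comp; try by sc_tac ok.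
by rewrite /abcop; field; rewrite z0 q0.
Qed.

Variables (E Ei : {rmorphism K -> K}) (z : K).
Hypotheses (EK : cancel Ei E) (EiK : cancel E Ei).
Hypotheses (Ez : E z = q * z) (Eiz : Ei z = z / q) (Sz : Sc z) (z0 : z != 0).
Hypotheses (Eal : E al = al) (Eq : E q = q) (ES : E S = S).
Hypotheses (Ea : forall f, E (a f) = a (E f)) (Eb : forall f, E (b f) = b (E f))
  (Ec : forall f, E (c f) = c (E f)).

Let Eial : Ei al = al. Proof. by rewrite -{1}Eal EiK. Qed.
Let Eiq : Ei q = q. Proof. by rewrite -{1}Eq EiK. Qed.
Let EiS : Ei S = S. Proof. by rewrite -{1}ES EiK. Qed.
Let Eia f : Ei (a f) = a (Ei f). Proof. by apply: (can_inj EiK); rewrite EK Ea EK. Qed.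
Let Eib f : Ei (b f) = b (Ei f). Proof. by apply: (can_inj EiK); rewrite EK Eb EK. Qed.
Let Eic f : Ei (c f) = c (Ei f). Proof. by apply: (can_inj EiK); rewrite EK Ec EK. Qed.

Definition stepTp f := stepM z (E f).
Definition stepTm f := stepM z^-1 (Ei f).

Lemma stepT0_Tp f : stepT0 z (stepTp f) = stepTp (stepT0 z f).
Proof.
rewrite /stepTp stepM_T0 //; congr (stepM _ _); rewrite /stepT0 /abcop.
by rewrite !(rmorphD, rmorphM, rmorphN, rmorphXn, rmorph1, rmorph0, fmorphV) /= Ea Eb Ec Eal Ez.
Qed.

Lemma stepT0V y f : stepT0 y^-1 f = stepT0 y f.
Proof. by rewrite /stepT0 invrK [y^-1 + y]addrC. Qed.

Lemma stepT0_Tm f : stepT0 z (stepTm f) = stepTm (stepT0 z f).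
Proof.
rewrite /stepTm -stepT0V stepM_T0 ?invr_eq0 //; last exact: (scV ok).
congr (stepM _ _); rewrite -stepT0V /stepT0 /abcop.
rewrite !(rmorphD, rmorphM, rmorphN, rmorphXn, rmorph1, rmorph0, fmorphV) /= Eia Eib Eic Eial Eiz.
have -> : (z / q)^-1 = q * z^-1 by rewrite invfM invrK mulrC.
by rewrite ?invfM ?invrK [q^-1 * z]mulrC.
Qed.

Definition mixp y := - al * S * (y + (q * y)^-1).
Definition mixr y :=
  al ^+ 2 * (t * q * y ^+ 2 + t / (q * y ^+ 2) + S ^+ 2 / q - 2 * t).

Lemma stepTp_Tm f :
  stepTp (stepTm f) = stepT0 z (stepT0 z f) + mixp z * stepT0 z f + mixr z * f.
Proof.
transitivity (stepM z (stepM (q * z)^-1 f)); last by rewrite stepM_M // /mixp !mulNr.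
congr (stepM _ _); rewrite /stepTm /stepM /abcop.
rewrite !(rmorphD, rmorphM, rmorphN, rmorphXn, rmorph1, rmorph0, fmorphV) /= Ea Eb Ec Eal Ez Eq ES.
by rewrite !EK.
Qed.

Lemma stepTm_Tp f :
  stepTm (stepTp f) = stepT0 z (stepT0 z f) + mixp z^-1 * stepT0 z f + mixr z^-1 * f.
Proof.
transitivity (stepM z^-1 (stepM (q * z^-1)^-1 f)); last first.
  rewrite stepM_M ?invr_eq0 //; last exact: (scV ok).
  by rewrite !stepT0V /mixp !mulNr.
congr (stepM _ _); rewrite /stepTp /stepM /abcop.
rewrite !(rmorphD, rmorphM, rmorphN, rmorphXn, rmorph1, rmorph0, fmorphV) /= Eia Eib Eic Eial Eiz Eiq EiS.
by rewrite !EiK invfM invrK [z / q]mulrC.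
Qed.

Lemma slin_abcop x1 x2 x3 x4 : Sc x1 -> Sc x2 -> Sc x3 -> Sc x4 ->
  slinear Sc (abcop x1 x2 x3 x4).
Proof.
case: abc => -[aD aZ] [bD bZ] [cD cZ] _ _ _ _ *; split=> [f g|x f Sx]; rewrite /abcop.
  by rewrite aD bD cD; ring.
by rewrite aZ // bZ // cZ //; ring.
Qed.

Lemma slin_stepM y : Sc y -> slinear Sc (stepM y).
Proof. by move=> Sy; apply: slin_abcop; sc_tac ok. Qed.

Lemma slin_stepT0 y : Sc y -> slinear Sc (stepT0 y).
Proof. by move=> Sy; apply: slin_abcop; sc_tac ok. Qed.

Definition stepop x1 x2 x3 x4 f := x1 * stepTp f + x2 * stepTm f + x3 * stepT0 z f + x4 * f.

(** Coefficients are handled as functions of $z$ because composing operators evaluates them at $qz$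
    and $z/q$. *)
Definition stepfun (y : K -> K) :=
  [/\ E (y z) = y (q * z), Ei (y z) = y (z / q) & forall w, Sc w -> Sc (y w)].

(** Mixed products of [stepTp] and [stepTm] are eliminated through [mixp] and [mixr], which leaves
    nine monomials. *)
Lemma stepop_comp x1 x2 x3 x4 (y1 y2 y3 y4 : K -> K) f :
  stepfun y1 -> stepfun y2 -> stepfun y3 -> stepfun y4 ->
  stepop x1 x2 x3 x4 (stepop (y1 z) (y2 z) (y3 z) (y4 z) f) =
    x1 * y1 (q * z) * stepTp (stepTp f) + x2 * y2 (z / q) * stepTm (stepTm f)
  + (x3 * y3 z + x1 * y2 (q * z) + x2 * y1 (z / q)) * stepT0 z (stepT0 z f)
  + (x1 * y3 (q * z) + x3 * y1 z) * stepTp (stepT0 z f)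
  + (x2 * y3 (z / q) + x3 * y2 z) * stepTm (stepT0 z f)
  + (x1 * y4 (q * z) + x4 * y1 z) * stepTp f
  + (x2 * y4 (z / q) + x4 * y2 z) * stepTm f
  + (x3 * y4 z + x4 * y3 z + x1 * y2 (q * z) * mixp z
     + x2 * y1 (z / q) * mixp z^-1) * stepT0 z f
  + (x4 * y4 z + x1 * y2 (q * z) * mixr z + x2 * y1 (z / q) * mixr z^-1) * f.
Proof.
move=> [Ey1 Eiy1 Sy1] [Ey2 Eiy2 Sy2] [Ey3 Eiy3 Sy3] [Ey4 Eiy4 Sy4].
have SzV : Sc z^-1 by exact: (scV ok).
have Sqz : Sc (q * z) by sc_tac ok.
have Szq : Sc (z / q) by sc_tac ok.
rewrite [in LHS]/stepop.
have -> : stepTp (stepop (y1 z) (y2 z) (y3 z) (y4 z) f) = y1 (q * z) * stepTp (stepTp f)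
    + y2 (q * z) * stepTp (stepTm f) + y3 (q * z) * stepTp (stepT0 z f) + y4 (q * z) * stepTp f.
  rewrite {1}/stepTp rmorph_op4 Ey1 Ey2 Ey3 Ey4 (slin_op4 _ _ _ _ (slin_stepM Sz)); by auto.
have -> : stepTm (stepop (y1 z) (y2 z) (y3 z) (y4 z) f) = y1 (z / q) * stepTm (stepTp f)
    + y2 (z / q) * stepTm (stepTm f) + y3 (z / q) * stepTm (stepT0 z f) + y4 (z / q) * stepTm f.
  rewrite {1}/stepTm rmorph_op4 Eiy1 Eiy2 Eiy3 Eiy4 (slin_op4 _ _ _ _ (slin_stepM SzV)); by auto.
rewrite /stepop (slin_op4 _ _ _ _ (slin_stepT0 Sz)); try by auto.
rewrite stepTp_Tm stepTm_Tp stepT0_Tp stepT0_Tm; ring.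
Qed.

(** * The moments after one more position, and the preservation of the relations *)

Definition momden y := (1 - y ^+ 2) * (1 - q * y ^+ 2).

(** The three summands collect the chains that avoid the new position, end there with sign $+1$, or
    end there with sign $-1$. *)
Definition stepmom r A f := A f + (z / al) ^+ r / momden z * stepM z (E f - f)
  + (z^-1 / al) ^+ r / momden z^-1 * stepM z^-1 (Ei f - f).

Hypotheses (zq1 : forall m, 1 - q ^+ m * z ^+ 2 != 0) (zq2 : forall m, q ^+ m - z ^+ 2 != 0).

Definition Dn y := (1 - q * y ^+ 2) * (q - y ^+ 2).
Definition momT r y := (y / al) ^+ r / momden y.
Definition momTV r y := (y^-1 / al) ^+ r / momden y^-1.
(* The coefficients of stepT0 z and of 1 that remain when stepM z and stepM z^-1
   are eliminated from stepmom. *)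
Definition momU0 y := - q * (1 + q) * y ^+ 2 / Dn y.
Definition momV0 y := q * S * al * y * (1 + y ^+ 2) / Dn y.
Definition momU1 y := - q * y * (1 + y ^+ 2) / (al * Dn y).
Definition momV1 y := S * (1 + q) * y ^+ 2 / Dn y.
Definition momU2 y := - (1 + q) * y ^+ 2 / (al ^+ 2 * Dn y).
Definition momV2 y := S * y * (1 + y ^+ 2) / (al * Dn y).

Lemma stepmom_Tp r A f : stepmom r A f = A f
  + (z / al) ^+ r / momden z * (stepTp f - stepM z f)
  + (z^-1 / al) ^+ r / momden z^-1 * (stepTm f - stepM z^-1 f).
Proof.
have SzV : Sc z^-1 by exact: (scV ok).
have sub y g h : Sc y -> stepM y (g - h) = stepM y g - stepM y h.
  move=> Sy; have [D Z] := slin_stepM Sy.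
  by rewrite D -mulN1r Z ?mulN1r //; apply: (scN ok); exact: (sc1 ok).
by rewrite /stepmom !sub.
Qed.

Let zz1 : 1 - z ^+ 2 != 0. Proof. by have := zq1 0; rewrite expr0 mul1r. Qed.
Let zz1' : z ^+ 2 - 1 != 0. Proof. by rewrite -opprB oppr_eq0. Qed.
Let zz2 : 1 - q * z ^+ 2 != 0. Proof. by have := zq1 1; rewrite expr1. Qed.
Let zz3 : q - z ^+ 2 != 0. Proof. by have := zq2 1; rewrite expr1. Qed.
Let zz3' : z ^+ 2 - q != 0. Proof. by rewrite -opprB oppr_eq0. Qed.

(** Interpolation, in the same way for the moments 0, 1, 2. Read $a,b,c$ as $1,u,u^2$. What remains
    of $u^r$ after subtracting the two [stepM] terms, apart from their parts with $S$, has degree at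
    most 2 and vanishes at $u=1/(\alpha z)$ and $u=z/\alpha$. These are the roots of $(1-\alpha
    zu)(1-\alpha u/z)$, the polynomial of [stepT0 z], so a multiple of it is left; the parts with
    $S$ give the constant. *)
Lemma stepmom0 f : stepmom 0 a f = stepop (momT 0 z) (momTV 0 z) (momU0 z) (momV0 z) f.
Proof.
rewrite stepmom_Tp /stepop /stepM /stepT0 /abcop /momT /momTV /momU0 /momV0 /momden /Dn.
by field; rewrite ?z0 ?al0 ?q0 ?zz1 ?zz2 ?zz3 ?zz1' ?zz3'.
Qed.

Lemma stepmom1 f : stepmom 1 b f = stepop (momT 1 z) (momTV 1 z) (momU1 z) (momV1 z) f.
Proof.
rewrite stepmom_Tp /stepop /stepM /stepT0 /abcop /momT /momTV /momU1 /momV1 /momden /Dn.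
by field; rewrite ?z0 ?al0 ?q0 ?zz1 ?zz2 ?zz3 ?zz1' ?zz3'.
Qed.

Lemma stepmom2 f : stepmom 2 c f = stepop (momT 2 z) (momTV 2 z) (momU2 z) (momV2 z) f.
Proof.
rewrite stepmom_Tp /stepop /stepM /stepT0 /abcop /momT /momTV /momU2 /momV2 /momden /Dn.
by field; rewrite ?z0 ?al0 ?q0 ?zz1 ?zz2 ?zz3 ?zz1' ?zz3'.
Qed.

Let Etac := (rmorphD, rmorphM, rmorphN, rmorphXn, rmorph1, fmorphV).

Lemma stepfun_momT r : stepfun (momT r).
Proof.
split=> [||w Sw]; rewrite /momT /momden; last by sc_tac ok.
  by rewrite !Etac /= Ez Eal Eq.
by rewrite !Etac /= Eiz Eial Eiq.
Qed.

Lemma stepfun_momTV r : stepfun (momTV r).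
Proof.
split=> [||w Sw]; rewrite /momTV /momden; last by sc_tac ok.
  by rewrite !Etac /= Ez Eal Eq.
by rewrite !Etac /= Eiz Eial Eiq.
Qed.

Lemma stepfun_momU : [/\ stepfun momU0, stepfun momU1 & stepfun momU2].
Proof.
split; split=> [||w Sw]; rewrite /momU0 /momU1 /momU2 /Dn; try by sc_tac ok.
all: by rewrite !Etac /= ?Ez ?Eiz ?Eal ?Eq ?Eial ?Eiq.
Qed.

Lemma stepfun_momV : [/\ stepfun momV0, stepfun momV1 & stepfun momV2].
Proof.
split; split=> [||w Sw]; rewrite /momV0 /momV1 /momV2 /Dn; try by sc_tac ok.
all: by rewrite !Etac /= ?Ez ?Eiz ?Eal ?Eq ?ES ?Eial ?Eiq ?EiS.
Qed.

(** Compares two normal forms monomial by monomial, so that [field] meets nine moderate identities.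
    The five quadratic monomials come first; the linear and constant terms of a relation affect only
    the last four. *)
Lemma lin9 (k s t' y6 y7 y8 y9 m1 m2 m3 m4 m5 m6 m7 m8 m9 w1 w2 w3 w4 w5 w6 w7 w8 w9
  v1 v2 v3 v4 v5 v6 v7 v8 v9 : K) :
  w1 = k * v1 -> w2 = k * v2 -> w3 = k * v3 -> w4 = k * v4 -> w5 = k * v5 ->
  w6 = k * v6 + s * y6 -> w7 = k * v7 + s * y7 -> w8 = k * v8 + s * y8 ->
  w9 = k * v9 + s * y9 + t' ->
  w1 * m1 + w2 * m2 + w3 * m3 + w4 * m4 + w5 * m5 + w6 * m6 + w7 * m7 + w8 * m8 + w9 * m9
  = k * (v1 * m1 + v2 * m2 + v3 * m3 + v4 * m4 + v5 * m5 + v6 * m6 + v7 * m7 + v8 * m8 + v9 * m9)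
    + s * (y6 * m6 + y7 * m7 + y8 * m8 + y9 * m9) + t' * m9.
Proof. by move=> -> -> -> -> -> -> -> -> ->; ring. Qed.

Ltac unf := rewrite /momT /momTV /momU0 /momV0 /momU1 /momV1 /momU2 /momV2 /momden /Dn /mixp /mixr.

(** Evaluating coefficients at $qz$ and $z/q$ brings in denominators with powers up to $q^3$. *)
Let c1 : 1 - q * (q * z) ^+ 2 != 0.
Proof. by rewrite (_ : _ - _ = 1 - q ^+ 3 * z ^+ 2) //; ring. Qed.
Let c2 : 1 - (q * z) ^+ 2 != 0. Proof. by rewrite exprMn. Qed.
Let c2' : (q * z) ^+ 2 - 1 != 0. Proof. by rewrite -opprB oppr_eq0. Qed.
Let c3 : q * q ^+ 2 - z ^+ 2 != 0. Proof. by rewrite -exprS. Qed.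
Let c3' : z ^+ 2 - q * q ^+ 2 != 0. Proof. by rewrite -opprB oppr_eq0. Qed.
Let c4 : q ^+ 2 - z ^+ 2 != 0. Proof. by []. Qed.
Let c4' : z ^+ 2 - q ^+ 2 != 0. Proof. by rewrite -opprB oppr_eq0. Qed.
Let c5 : q * z ^+ 2 - 1 != 0. Proof. by rewrite -opprB oppr_eq0. Qed.
Let c6 : q - (q * z) ^+ 2 != 0.
Proof. by rewrite (_ : _ - _ = q * (1 - q * z ^+ 2)) ?mulf_neq0 //; ring. Qed.

Ltac cond := rewrite ?z0 ?al0 ?q0 ?zz1 ?zz2 ?zz3 ?zz1' ?zz3' ?c1 ?c2 ?c2' ?c3 ?c3' ?c4 ?c4' ?c5 ?c6.

Ltac step_rel := have [U0 U1 U2] := stepfun_momU; have [V0 V1 V2] := stepfun_momV;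
  rewrite ?stepmom0 ?stepmom1 ?stepmom2 !stepop_comp //;
  try exact: stepfun_momT; try exact: stepfun_momTV.

Lemma step_AB f : stepmom 0 a (stepmom 1 b f) = q * stepmom 1 b (stepmom 0 a f).
Proof.
(* This relation has no linear or constant part; zeros are inserted to fit the shape of [lin9]. *)
step_rel; match goal with |- ?l = _ * ?r =>
  suff -> : l = q * r + 0 * (0 * stepTp f + 0 * stepTm f + 0 * stepT0 z f + 0 * f) + 0 * f
end; first by rewrite !mul0r !addr0.
by apply: lin9; unf; field; cond.
Qed.

Lemma step_BC f : stepmom 1 b (stepmom 2 c f) = q * stepmom 2 c (stepmom 1 b f).
Proof.
step_rel; match goal with |- ?l = _ * ?r =>
  suff -> : l = q * r + 0 * (0 * stepTp f + 0 * stepTm f + 0 * stepT0 z f + 0 * f) + 0 * f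
end; first by rewrite !mul0r !addr0.
by apply: lin9; unf; field; cond.
Qed.

Lemma step_AC f : stepmom 0 a (stepmom 2 c f)
  = q * stepmom 1 b (stepmom 1 b f) + S * stepmom 1 b f + t * f.
Proof. by step_rel; apply: lin9; unf; field; cond. Qed.

Lemma step_CA f : stepmom 2 c (stepmom 0 a f)
  = q^-1 * stepmom 1 b (stepmom 1 b f) + S / q * stepmom 1 b f + t * f.
Proof. by step_rel; apply: lin9; unf; field; cond. Qed.

Lemma slin_stepop x1 x2 x3 x4 (Sc' : K -> Prop) :
  (forall x, Sc' x -> Sc x /\ E x = x) -> slinear Sc' (stepop x1 x2 x3 x4).
Proof.
move=> Sc'P; have SzV : Sc z^-1 by exact: (scV ok).
have [D0 Z0] := slin_stepT0 Sz; have [Dp Zp] := slin_stepM Sz; have [Dm Zm] := slin_stepM SzV.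
split=> [f g|x f /Sc'P[Sx Ex]]; rewrite /stepop /stepTp /stepTm.
  by rewrite !rmorphD Dp Dm D0 !mulrDr; ring.
have Eix : Ei x = x by rewrite -{1}Ex EiK.
by rewrite !rmorphM /= Ex Eix Zp // Zm // Z0 //; ring.
Qed.

(** The new moments shift $z$, so a scalar for them must in addition be fixed by [E]. *)
Lemma step_triple (Sc' : K -> Prop) : (forall x, Sc' x -> Sc x /\ E x = x) ->
  awtriple q S t Sc' (stepmom 0 a) (stepmom 1 b) (stepmom 2 c).
Proof.
move=> Sc'P; split; [| | |exact: step_AB|exact: step_BC|exact: step_AC|exact: step_CA].
- have [D Z] := slin_stepop (momT 0 z) (momTV 0 z) (momU0 z) (momV0 z) Sc'P.
  by split=> *; rewrite !stepmom0 ?D // Z.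
- have [D Z] := slin_stepop (momT 1 z) (momTV 1 z) (momU1 z) (momV1 z) Sc'P.
  by split=> *; rewrite !stepmom1 ?D // Z.
have [D Z] := slin_stepop (momT 2 z) (momTV 2 z) (momU2 z) (momV2 z) Sc'P.
by split=> *; rewrite !stepmom2 ?D // Z.
Qed.

(** The coefficients are scalars for [stepT0 z], and it commutes with [stepTp] and [stepTm]. This is
    the origin of the commutativity of the difference operators. *)
Lemma stepT0_stepop x1 x2 x3 x4 f : Sc x1 -> Sc x2 -> Sc x3 -> Sc x4 ->
  stepT0 z (stepop x1 x2 x3 x4 f) = stepop x1 x2 x3 x4 (stepT0 z f).
Proof.
by move=> *; rewrite /stepop (slin_op4 _ _ _ _ (slin_stepT0 Sz)) // stepT0_Tp stepT0_Tm.
Qed.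

Lemma stepT0_stepmom r f : (r < 3)%N ->
  let A := nth a [:: a; b; c] r in stepT0 z (stepmom r A f) = stepmom r A (stepT0 z f).
Proof.
have [[_ _ U0] [_ _ U1] [_ _ U2]] := stepfun_momU.
have [[_ _ V0] [_ _ V1] [_ _ V2]] := stepfun_momV.
have T r0 := let: And3 _ _ H := stepfun_momT r0 in H.
have TV r0 := let: And3 _ _ H := stepfun_momTV r0 in H.
move=> r3 A; rewrite {}/A; case: r r3 => [|[|[|//]]] _ /=.
- by rewrite !stepmom0 stepT0_stepop //; auto.
- by rewrite !stepmom1 stepT0_stepop //; auto.
by rewrite !stepmom2 stepT0_stepop //; auto.
Qed.

Section Commutant.
Variable T : K -> K.
Hypotheses (Tlin : slinear Sc T)
  (Ta : forall f, T (a f) = a (T f)) (Tb : forall f, T (b f) = b (T f))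
  (Tc : forall f, T (c f) = c (T f)).

Lemma commute_abcop x1 x2 x3 x4 f : Sc x1 -> Sc x2 -> Sc x3 -> Sc x4 ->
  T (abcop x1 x2 x3 x4 f) = abcop x1 x2 x3 x4 (T f).
Proof. by move=> *; rewrite /abcop (slin_op4 _ _ _ _ Tlin) // Ta Tb Tc. Qed.

Lemma commute_stepT0 w f : Sc w -> T (stepT0 w f) = stepT0 w (T f).
Proof. by move=> Sw; apply: commute_abcop; sc_tac ok. Qed.

Hypotheses (TE : forall f, T (E f) = E (T f)) (TEi : forall f, T (Ei f) = Ei (T f)).

(** Carries commutation on to all later levels: a new moment is built from the old ones and the new
    shift, with coefficients that are scalars for [T]. *)
Lemma commute_stepmom r A f : (forall g, T (A g) = A (T g)) ->
  T (stepmom r A f) = stepmom r A (T f).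
Proof.
move=> TA; have [TD TZ] := Tlin; have SzV : Sc z^-1 by exact: (scV ok).
have TM w g : Sc w -> T (stepM w g) = stepM w (T g).
  by move=> Sw; apply: commute_abcop; sc_tac ok.
have TB g h : T (g - h) = T g - T h.
  by rewrite TD -mulN1r TZ ?mulN1r //; apply: (scN ok); exact: (sc1 ok).
by rewrite /stepmom !TD TA !TZ ?TM // ?TB ?TE ?TEi // /momden; sc_tac ok.
Qed.
End Commutant.

(** * Eigenfunctions: passing from one factor of the product to the next *)

Section Eigen.
Variables (a0 QN G : K).
Hypotheses (a00 : a0 != 0) (SE : S = 1 + a0 ^- 2) (tE : t = (q * a0 ^+ 2)^-1) (QN0 : QN != 0).

(** For $Q=1$ this is the weight of a first link. In general $\alpha$ is replaced by $\alpha Q$,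
    where $Q=q^{N_j}$ records the degrees already used, and the weight is divided by $Q$. *)
Definition eigM al1 Q w := Q^-1 * (1 - al1 * Q * w) * (1 - al1 / a0 ^+ 2 * Q * w).
Definition eigT0 al1 Q := Q^-1 + al1 ^+ 2 * Q * t.

Hypotheses (Gp : stepTp G = eigM al QN z * G) (Gm : stepTm G = eigM al QN z^-1 * G)
  (G0 : stepT0 z G = eigT0 al QN * G).

Lemma stepop_eigen x1 x2 x3 x4 p : Sc p -> Sc (E p) -> Sc (Ei p) ->
  stepop x1 x2 x3 x4 (p * G) = (x1 * eigM al QN z * E p + x2 * eigM al QN z^-1 * Ei p
    + x3 * eigT0 al QN * p + x4 * p) * G.
Proof.
move=> Sp SEp SEip; rewrite /stepop.
have SzV : Sc z^-1 by exact: (scV ok).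
have -> : stepTp (p * G) = E p * stepTp G.
  by rewrite /stepTp rmorphM (slinZ (slin_stepM Sz)).
have -> : stepTm (p * G) = Ei p * stepTm G.
  by rewrite /stepTm rmorphM (slinZ (slin_stepM SzV)).
by rewrite (slinZ (slin_stepT0 Sz)) // Gp Gm G0; ring.
Qed.

Variables (al1 w : K).
Hypotheses (w0 : w != 0).

Local Notation aa := (al * QN).
Local Notation bb := (al / a0 ^+ 2 * QN).
Local Notation cc := (al1 / al * w).

(** The coefficient of [E p] factors: [eigM] supplies the numerator factors for [aa] and [bb], and
    the polynomial of the next [stepT0], taken at $u=z/\alpha$, those for the other two parameters.
    In [step_eigen1] the polynomial of [stepM] gives the parameters [cc] and [q * cc] instead. *)
Lemma step_eigen0 p : Sc p -> Sc (E p) -> Sc (Ei p) ->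
  1 * stepmom 0 a (p * G) + (- al1 * (w + w^-1)) * stepmom 1 b (p * G)
    + al1 ^+ 2 * stepmom 2 c (p * G) + 0 * (p * G)
  = (QN^-1 * awdiff q aa bb cc (al1 / al / w) z p (E p) (Ei p) + eigT0 al1 QN * p) * G.
Proof.
move=> Sp SEp SEip; rewrite !stepmom0 !stepmom1 !stepmom2 !stepop_eigen //.
rewrite !mulrA -!mulrDl; congr (_ * G).
rewrite /awdiff /awcoef /eigM /eigT0; unf; rewrite ?SE ?tE; move: (E p) (Ei p) => p1 p2.
by field; rewrite ?a00 ?QN0 ?w0; cond.
Qed.

Lemma step_eigen1 p : Sc p -> Sc (E p) -> Sc (Ei p) ->
  1 * stepmom 0 a (p * G) + (- al1 * w * (1 + q)) * stepmom 1 b (p * G)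
    + (q * al1 ^+ 2 * w ^+ 2) * stepmom 2 c (p * G) + (- al1 * w * S) * (p * G)
  = QN^-1 * ((1 - aa * cc) * (1 - bb * cc) * p
     + awdiff q aa bb cc (q * cc) z p (E p) (Ei p)) * G.
Proof.
move=> Sp SEp SEip; rewrite !stepmom0 !stepmom1 !stepmom2 !stepop_eigen //.
rewrite !mulrA -!mulrDl; congr (_ * G).
rewrite /awdiff /awcoef /eigM /eigT0; unf; rewrite ?SE ?tE; move: (E p) (Ei p) => p1 p2.
by field; rewrite ?a00 ?QN0 ?w0; cond.
Qed.

Hypotheses (qn1 : forall n, 1 - q ^+ n.+1 != 0) (Ew : E w = w) (Eal1 : E al1 = al1)
  (EQN : E QN = QN) (Ea0 : E a0 = a0).
Variable n : nat.
Local Notation aw := (fun x => askey_wilson q n x aa bb).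

Let Eaw x u v : E u = u -> E v = v -> E (aw x u v) = aw (E x) u v.
Proof.
move=> Eu Ev; rewrite rmorph_askey_wilson // Eu Ev.
by rewrite !(rmorphM, fmorphV, rmorphXn) /= Eal EQN Ea0.
Qed.

Let Eiaw x u v : E u = u -> E v = v -> Ei (aw x u v) = aw (Ei x) u v.
Proof.
move=> Eu Ev; apply: (can_inj EiK); rewrite EK Eaw //.
by rewrite EK.
Qed.

Lemma step_eigen0_aw (p := aw z cc (al1 / al / w)) : Sc p -> Sc (E p) -> Sc (Ei p) ->
  1 * stepmom 0 a (p * G) + (- al1 * (w + w^-1)) * stepmom 1 b (p * G)
    + al1 ^+ 2 * stepmom 2 c (p * G) + 0 * (p * G)
  = eigT0 al1 (QN * q ^+ n) * (p * G).
Proof.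
move=> Sp SEp SEip; rewrite step_eigen0 // [RHS]mulrA; congr (_ * G).
have Ecc : E cc = cc by rewrite !(rmorphM, fmorphV) /= Eal Eal1 Ew.
have Eee : E (al1 / al / w) = al1 / al / w by rewrite !(rmorphM, fmorphV) /= Eal Eal1 Ew.
rewrite {1 2}/p Eaw // Eiaw // Ez Eiz askey_wilson_eq // -/p.
have := expf_neq0 n q0; move: (q ^+ n) p {Sp SEp SEip} => Q p Q0.
by rewrite /eigT0 tE; field; rewrite ?a00 ?QN0 ?w0 ?Q0; cond.
Qed.

(** [P] is the current factor after $w\mapsto qw$. The left side is [stepM] of the next level, so
    for $w$ the next variable this evaluates the next [stepTp]. *)
Lemma step_eigen1_aw (P := aw z (q * cc) (al1 / al / w / q)) (p := aw z cc (al1 / al / w)) :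
  Sc P -> Sc (E P) -> Sc (Ei P) ->
  1 * stepmom 0 a (P * G) + (- al1 * w * (1 + q)) * stepmom 1 b (P * G)
    + (q * al1 ^+ 2 * w ^+ 2) * stepmom 2 c (P * G) + (- al1 * w * S) * (P * G)
  = eigM al1 (QN * q ^+ n) w * (p * G).
Proof.
move=> Sp SEp SEip; rewrite step_eigen1 // [RHS]mulrA; congr (_ * G).
have Ecc : E (q * cc) = q * cc by rewrite !(rmorphM, fmorphV) /= Eal Eal1 Ew Eq.
have Eee : E (al1 / al / w / q) = al1 / al / w / q.
  by rewrite !(rmorphM, fmorphV) /= Eal Eal1 Ew Eq.
rewrite {2 3}/P Eaw // Eiaw // Ez Eiz askey_wilson_eq1 // -/p.
have := expf_neq0 n q0; move: (q ^+ n) p {Sp SEp SEip} => Q p Q0.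
by rewrite /eigM; field; rewrite ?a00 ?QN0 ?w0 ?Q0; cond.
Qed.
End Eigen.
End Step.

Lemma stepmom_ext (K : fieldType) (q S S' : K) (a b c a' b' c' : K -> K) al al' (E Ei : {rmorphism K -> K})
  z r (A A' : K -> K) f : S = S' -> al = al' -> a =1 a' -> b =1 b' -> c =1 c' -> A =1 A' ->
  stepmom q S a b c al E Ei z r A f = stepmom q S' a' b' c' al' E Ei z r A' f.
Proof. by move=> -> -> ea eb ec eA; rewrite /stepmom /stepM /abcop !ea !eb !ec eA. Qed.

Lemma stepT0_ext (K : fieldType) (a b c a' b' c' : K -> K) al al' w w' f :
  al = al' -> w = w' -> a =1 a' -> b =1 b' -> c =1 c' ->
  stepT0 a b c al w f = stepT0 a' b' c' al' w' f.
Proof. by move=> -> -> ea eb ec; rewrite /stepT0 /abcop ea eb ec. Qed.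


(** With $x=\alpha^2/(q\alpha_0^2)$ it is the factorization $Q^{-1}+xQ-1-x=-(1-Q^{-1})(1-xQ)$. *)
Lemma eigT0_mu (F K : fieldType) (h : {rmorphism F -> K}) (q al a0 : F) n : q != 0 -> a0 != 0 ->
  eigT0 (h q * h a0 ^+ 2)^-1 (h al) (h q ^+ n) - (1 + h al ^+ 2 / (h q * h a0 ^+ 2))
  = h (- (1 - q ^- n) * (1 - al ^+ 2 / a0 ^+ 2 * q ^ (n%:Z - 1))).
Proof.
move=> q0 a00; rewrite expfzDr // exprN1 -exprnP.
rewrite !(rmorphM, rmorphN, rmorphB, rmorphXn, rmorph1, fmorphV) /eigT0 /=.
have hq0 : h q != 0 by rewrite fmorph_eq0.
have ha0 : h a0 != 0 by rewrite fmorph_eq0.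
have hQ0 := expf_neq0 n hq0; move: hQ0 hq0 ha0; move: (h q ^+ n) (h q) (h a0) (h al) => Q x y z Q0 x0 y0.
by field; rewrite Q0 x0 y0.
Qed.

Lemma sub_comm (K : fieldType) (x y z u v f : K) :
  z - u * x - v * (y - u * f) = z - v * y - u * (x - v * f).
Proof. by ring. Qed.

Lemma eigM_base (K : fieldType) (q a0 al z : K) : q != 0 -> a0 != 0 ->
  1 + - al * z * (1 + q) * 0 + q * al ^+ 2 * z ^+ 2 * (q * a0 ^+ 2)^-1 + - al * z * (1 + a0 ^- 2)
  = eigM a0 al 1 z.
Proof. by move=> q0 a00; rewrite /eigM; field; rewrite ?q0 ?a00 ?oner_neq0. Qed.

Lemma mul_sum4 (K : fieldType) (x1 x2 x3 x4 y1 y2 y3 y4 z : K) :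
  x1 * (y1 * z) + x2 * (y2 * z) + x3 * (y3 * z) - x4 * (y4 * z)
  = (x1 * y1 + x2 * y2 + x3 * y3 - x4 * y4) * z.
Proof. by ring. Qed.

(** Origin of the constants. Assigning moments $1,0,t$ to the empty chain makes the first link look
    like every later one: the quadratic term forces $t=1/(q\alpha_0^2)$, and the linear term has to
    be supplied by $S=1+\alpha_0^{-2}$. *)
Lemma first_link_moments (K : fieldType) (q a0 al y : K) : q != 0 -> a0 != 0 ->
  (1 - al * y) * (1 - al * y / a0 ^+ 2)
  = 1 * 1 + (- al * y * (1 + q)) * 0 + (q * al ^+ 2 * y ^+ 2) * (q * a0 ^+ 2)^-1
    + (- al * y * (1 + a0 ^- 2)) * 1.
Proof. by move=> q0 a00; field; rewrite q0 a00. Qed.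

Lemma link_moments (K : fieldType) (q al y x be w : K) :
  w * ((1 - al * y * x / be) * (1 - q * al * y * x / be))
  = 1 * (w * (x / be) ^+ 0) + (- al * y * (1 + q)) * (w * (x / be) ^+ 1)
    + (q * al ^+ 2 * y ^+ 2) * (w * (x / be) ^+ 2).
Proof. by ring. Qed.

Lemma last_link_moments (K : fieldType) (al y x be w : K) : y != 0 ->
  w * ((1 - al * y * x / be) * (1 - al * x / (be * y)))
  = 1 * (w * (x / be) ^+ 0) + (- al * (y + y^-1)) * (w * (x / be) ^+ 1)
    + al ^+ 2 * (w * (x / be) ^+ 2).
Proof. by move=> y0; rewrite invfM; move: be^-1 => b'; field. Qed.

(** Within a chain the position determines the sign. *)
Lemma uniq_fst_inj (T U : eqType) (c : seq (T * U)) :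
  uniq (map fst c) -> {in c &, injective fst}.
Proof.
elim: c => //= x c IH /andP[xc /IH{}IH] u v; rewrite !inE => /predU1P[->|uc] /predU1P[->|vc] //.
- by move=> e; case/negP: xc; rewrite e map_f.
- by move=> e; case/negP: xc; rewrite -e map_f.
exact: IH.
Qed.

Lemma mulr_div_rcons (K : fieldType) (x y z u v : K) : x * (y * z) / (u * v) = x * y / u * z / v.
Proof. by rewrite invfM; ring. Qed.

(** * Sign vectors as chains of signed positions *)

Section Chains.
Variables (F : fieldType) (d : nat).
Local Notation K := (ratfun F d).

(* true stands for the sign +1. *)
Definition chain_of j (nu : signvec j) : seq (nat * bool) :=
  [seq (i.+1, 0 < sgnv nu i) | i : 'I_j <- enum 'I_j & sgnv nu i != 0].

Definition chain_pos (c : seq (nat * bool)) := [seq y.1 | y <- c & y.2].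
Definition chain_neg (c : seq (nat * bool)) := [seq y.1 | y <- c & ~~ y.2].

Lemma supp_chain j (nu : signvec j) : supp nu = map fst (chain_of nu).
Proof. by rewrite /chain_of -map_comp. Qed.

Lemma pos_chain j (nu : signvec j) : pos nu = chain_pos (chain_of nu).
Proof.
rewrite /chain_pos /chain_of filter_map -map_comp -filter_predI; congr map.
apply: eq_filter => i /=; case: ltgtP; rewrite ?andbT ?andbF //=.
Qed.

Lemma neg_chain j (nu : signvec j) : neg nu = chain_neg (chain_of nu).
Proof.
rewrite /chain_neg /chain_of filter_map -map_comp -filter_predI; congr map.
by apply: eq_filter => i /=; case: ltgtP.
Qed.

(** The recursion removes the last position; its three cases match the three summands of
    [stepmom]. *)
Fixpoint chains j : seq (seq (nat * bool)) :=
  if j is i.+1 then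
    chains i ++ [seq rcons c (i.+1, true) | c <- chains i]
      ++ [seq rcons c (i.+1, false) | c <- chains i]
  else [:: [::]].

Definition ext_sign j (nu : signvec j) (s : 'I_3) : signvec j.+1 :=
  [ffun i : 'I_j.+1 => oapp nu s (insub (i : nat))].

Lemma ext_sign_widen j nu s (i : 'I_j) : @ext_sign j nu s (widen_ord (leqnSn j) i) = nu i.
Proof. by rewrite ffunE /= valK. Qed.

Lemma ext_sign_max j nu s : @ext_sign j nu s ord_max = s.
Proof. by rewrite ffunE /= insubF ?ltnn. Qed.

Lemma chain_of_ext j (nu : signvec j) s : chain_of (ext_sign nu s) =
  if s == 1%N :> nat then chain_of nu else rcons (chain_of nu) (j.+1, (1 < s)%N).
Proof.
rewrite /chain_of enum_ordSr filter_rcons.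
have -> : (sgnv (ext_sign nu s) ord_max != 0) = (s != 1%N :> nat).
  by rewrite /sgnv ext_sign_max; case: s => [[|[|[]]]].
have e : [seq (i.+1, 0 < sgnv (ext_sign nu s) i) |
    i : 'I_j.+1 <- [seq i <- [seq widen_ord (leqnSn j) i | i <- enum 'I_j] | sgnv (ext_sign nu s) i != 0]]
    = chain_of nu.
  rewrite filter_map -map_comp /chain_of.
  rewrite (eq_filter (a2 := fun i => sgnv nu i != 0)); last first.
    by move=> i /=; rewrite /sgnv ext_sign_widen.
  by apply: eq_map => i /=; rewrite /sgnv ext_sign_widen.
case: eqP => s1 /=; first exact: e.
rewrite map_rcons; congr rcons; first exact: e.
by rewrite /sgnv ext_sign_max; case: s s1 {e} => [[|[|[]]]].
Qed.

Lemma sum_chains j (G : seq (nat * bool) -> K) :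
  \sum_(nu : signvec j) G (chain_of nu) = \sum_(c <- chains j) G c.
Proof.
elim: j G => [|j IH] G.
  rewrite big_seq1 (eq_bigr (fun=> G [::])); last first.
    by move=> nu _; rewrite /chain_of (size0nil (size_enum_ord 0)).
  by rewrite sumr_const card_ffun !card_ord expn0.
rewrite (reindex (fun p : signvec j * 'I_3 => ext_sign p.1 p.2)) /=; last first.
  exists (fun nu : signvec j.+1 => ([ffun i => nu (widen_ord (leqnSn j) i)], nu ord_max)).
    move=> [nu s] _ /=; congr pair; last exact: ext_sign_max.
    by apply/ffunP => i; rewrite ffunE ext_sign_widen.
  move=> nu _ /=; apply/ffunP => i; rewrite ffunE.
  case: insubP => [i' _ e|] /=; first by rewrite ffunE; congr (nu _); apply: val_inj.
  rewrite -leqNgt => ji; congr (nu _); apply: val_inj => /=.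
  by apply/eqP; rewrite eqn_leq ji -ltnS ltn_ord.
rewrite -(pair_bigA _ (fun nu s => G (chain_of (ext_sign nu s)))) /=.
under eq_bigr => nu _.
  rewrite !big_ord_recl big_ord0 !chain_of_ext /= addr0. over.
rewrite !big_split /= IH (IH (fun c => G (rcons c (j.+1, true)))) (IH (fun c => G (rcons c (j.+1, false)))).
by rewrite !big_cat !big_map /= addrC -addrA.
Qed.

Lemma chains_ok j c : c \in chains j ->
  all (fun y => 1 <= y.1 <= j)%N c && uniq (map fst c).
Proof.
elim: j c => [|j IH] c /=; first by rewrite inE => /eqP->.
have mono : forall c', all (fun y => 1 <= y.1 <= j)%N c' -> all (fun y => 1 <= y.1 <= j.+1)%N c'.
  by move=> c'; apply: sub_all => y /andP[-> /= /leqW].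
have ext b c' : c' \in chains j -> all (fun y => 1 <= y.1 <= j.+1)%N (rcons c' (j.+1, b))
    && uniq (map fst (rcons c' (j.+1, b))).
  move=> /IH/andP[H1 H2]; rewrite all_rcons map_rcons rcons_uniq H2 mono //= leqnn /= andbT.
  by apply/negP=> /mapP[y /(allP H1)/andP[_ yj] e]; move: yj; rewrite -e ltnn.
rewrite !mem_cat => /or3P[/IH/andP[H1 ->]|/mapP[c' c'j ->]|/mapP[c' c'j ->]].
- by rewrite mono.
- exact: ext.
exact: ext.
Qed.

Variable q : F.
Hypothesis q0 : q != 0.

(** Applying the involutions $I^{\nu^-}$ to a coefficient amounts to putting [zeta] in place of each
    $z_i$ on the chain. *)
Definition zeta (y : nat * bool) : K := if y.2 then zvar y.1 else (zvar y.1)^-1.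
(** For sign $-1$ this is the negative of [nabla], which absorbs the factor $(-1)^{|\nu^-|}$. *)
Definition zstep (y : nat * bool) (f : K) : K := shiftm (if y.2 then q else q^-1) y.1 f - f.
Definition zsteps (c : seq (nat * bool)) (f : K) : K := foldr zstep f c.

Lemma compose_triangle_nabla k s f : (1 <= k <= d)%N -> k \notin s ->
  all (fun l => 1 <= l <= d)%N s ->
  compose (@triangle F q d) s (nabla q k f) = nabla q k (compose (@triangle F q d) s f).
Proof.
move=> kd; elim: s => //= l s IH; rewrite inE negb_or => /andP[kl ks] /andP[ld sd].
rewrite /comp /= IH // /nabla /triangle !shiftmE ?invr_eq0 // !rmorphB /=.
have lk : l != k by rewrite eq_sym.
have e g : shiftm q l (shiftm q^-1 k g) = shiftm q^-1 k (shiftm q l g) := shiftmC q q^-1 lk ld kd g.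
rewrite e.
by rewrite !opprB addrACA [RHS]addrACA; congr (_ + _); rewrite addrC.
Qed.

Lemma compose_zsteps c f : all (fun y => 1 <= y.1 <= d)%N c -> uniq (map fst c) ->
  (-1) ^+ size (chain_neg c) * compose (@triangle F q d) (chain_pos c)
     (compose (@nabla F q d) (chain_neg c) f) = zsteps c f.
Proof.
elim: c => [_ _|[k b] c IH /andP[kd cd] /andP[kc uc]]; first by rewrite /= mul1r.
move: kd kc => /= kd kc; case: b; rewrite /chain_neg /chain_pos /=.
  rewrite -/(chain_pos c) -/(chain_neg c) -IH // /comp /triangle /zstep /= shiftmE //.
  by rewrite rmorphM rmorphXn rmorphN1 /= mulrBr.
have kp : k \notin chain_pos c.
  by apply: contra kc => /mapP[y]; rewrite mem_filter => /andP[_ yc ->]; apply: map_f.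
have pd : all (fun l => 1 <= l <= d)%N (chain_pos c).
  by apply/allP => l /mapP[y]; rewrite mem_filter => /andP[_ /(allP cd) yd ->].
rewrite -/(chain_pos c) -/(chain_neg c) /comp compose_triangle_nabla // -IH // exprS mulN1r mulNr.
rewrite /nabla /zstep /= shiftmE ?invr_eq0 // rmorphM rmorphXn rmorphN1 /=.
by rewrite mulrBr opprB.
Qed.

Lemma zinv_coefA k j a z s : zinv k (coefA (cst d q) j a z s)
  = coefA (cst d q) j (fun i => zinv k (a i)) (fun i => zinv k (z i)) s.
Proof.
rewrite /coefA !(rmorphM, rmorphB, rmorph1, fmorphV, rmorphXn, rmorph_prod) /=.
congr (_ * (_ / _) * _ * _); apply: eq_bigr => p _.
  by rewrite !(rmorphM, rmorphB, rmorph1, fmorphV, rmorphXn) /= zinv_cst.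
by rewrite !(rmorphM, rmorphB, rmorph1, fmorphV, rmorphXn) /= zinv_cst.
Qed.

Lemma compose_zinv_coefA t j a z s : compose (@zinv F d) t (coefA (cst d q) j a z s)
  = coefA (cst d q) j (fun i => compose (@zinv F d) t (a i))
     (fun i => compose (@zinv F d) t (z i)) s.
Proof. by elim: t => //= k t IH; rewrite /comp /= IH zinv_coefA. Qed.

Lemma compose_zinv_zvar t k : (1 <= k <= d)%N -> uniq t ->
  compose (@zinv F d) t (zvar k) = if k \in t then (zvar k)^-1 else zvar k.
Proof.
move=> kd; elim: t => //= l t IH /andP[lt ut]; rewrite /comp IH // inE.
have [e|kl] /= := eqVneq k l.
  by rewrite e (negPf lt) zinv_zvar ?eqxx // -e.
by case: ifP => _; rewrite ?fmorphV /= zinv_zvar // (negPf kl).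
Qed.

(** * Coefficients of the difference operator as chain weights, and the moments as sums over
    chains *)

Section Weights.
Variable a : nat -> K.
Local Notation qK := (cst d q).

Lemma qK0 : qK != 0. Proof. by rewrite fmorph_eq0. Qed.

Definition link x y := (1 - a y.1 * zeta y * zeta x / a x.1)
  * (1 - qK * a y.1 * zeta y * zeta x / a x.1).

Fixpoint links x c : K := if c is y :: c' then link x y * links y c' else 1.

Lemma links_rcons x c y : links x (rcons c y) = links x c * link (last x c) y.
Proof. by elim: c x => [|u c IH] x /=; rewrite ?mulr1 ?mul1r // IH mulrA. Qed.

Definition link0 y := (1 - a y.1 * zeta y) * (1 - a y.1 * zeta y / a 0 ^+ 2).

Definition chain_wt c : K :=
  if c is x :: c' then link0 x * links x c' / \prod_(y <- c) momden qK (zeta y) else 1.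

Lemma chain_wt_rcons c y : chain_wt (rcons c y) =
  (if c is x :: c' then chain_wt c * link (last x c') y else link0 y) / momden qK (zeta y).
Proof.
case: c => [|x c]; first by rewrite /= big_seq1 mulr1.
rewrite /chain_wt rcons_cons links_rcons -rcons_cons -cats1 big_cat big_seq1 /=.
exact: mulr_div_rcons.
Qed.

Definition last_wt j x : K :=
  (1 - a j.+1 * a j.+2 * zeta x / a x.1) * (1 - a j.+1 * zeta x / (a x.1 * a j.+2)).

(** The parameters are only required to be invariant under inversion of $z_1,\dots,z_j$, because
    $a_{j+2}$ will be the variable $z_{j+1}$. *)
Lemma coefA_chain j x c : (j <= d)%N -> (forall i k, (1 <= k <= j)%N -> zinv k (a i) = a i) ->
  let xc := x :: c in all (fun y => 1 <= y.1 <= j)%N xc -> uniq (map fst xc) ->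
  compose (@zinv F d) (chain_neg xc) (coefA qK j a zvar (map fst xc))
  = chain_wt xc * last_wt j (last x c).
Proof.
move=> jd aI xc xcj uxc; rewrite compose_zinv_coefA.
have xcd y : y \in xc -> (1 <= y.1 <= d)%N.
  by move=> /(allP xcj)/andP[-> /= /leq_trans]; apply.
have uneg : uniq (chain_neg xc).
  by apply: subseq_uniq uxc; apply: map_subseq; apply: filter_subseq.
set b := fun i => compose _ _ (a i); set z := fun i => compose _ _ (zvar i).
have bE i : b i = a i.
  rewrite /b; have : all (fun k => 1 <= k <= j)%N (chain_neg xc).
    by apply/allP => l /mapP[y]; rewrite mem_filter => /andP[_ /(allP xcj) yd ->].
  by elim: (chain_neg xc) => //= k s IH /andP[kj /IH]; rewrite /comp => ->; apply: aI.
have zE y : y \in xc -> z y.1 = zeta y.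
  move=> yc; rewrite /z compose_zinv_zvar ?xcd // /zeta.
  suff -> : (y.1 \in chain_neg xc) = ~~ y.2 by case: y.2.
  apply/mapP/idP => [[y']|ny]; last by exists y; rewrite // mem_filter ny.
  rewrite mem_filter => /andP[ny' y'c] e; suff -> : y = y' by [].
  exact: (uniq_fst_inj uxc).
have prodE : forall c' x', {subset x' :: c' <= xc} ->
    \prod_(p <- zip (x'.1 :: map fst c') (map fst c'))
      ((1 - b p.2 * z p.2 * z p.1 / b p.1) * (1 - qK * b p.2 * z p.2 * z p.1 / b p.1))
    = links x' c'.
  elim=> [|y c' IH] x' sub /=; first by rewrite big_nil.
  rewrite big_cons IH; last by move=> u uc; apply: sub; rewrite inE uc orbT.
  by rewrite !bE !zE ?sub ?inE ?eqxx ?orbT.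
have lastin : last x c \in xc by rewrite /xc mem_last.
rewrite /coefA.
have -> : last 0%N (map fst xc) = (last x c).1 by rewrite /= (last_map fst).
have -> : head 0%N (map fst xc) = x.1 by [].
have -> : behead (map fst xc) = map fst c by [].
rewrite [X in zip X _](_ : _ = x.1 :: map fst c) // prodE // !bE !zE ?mem_head //.
rewrite /chain_wt /last_wt /link0 -/xc !mulrA.
have -> : \prod_(i <- x.1 :: map fst c) ((1 - z i ^+ 2) * (1 - qK * z i ^+ 2))
    = \prod_(y <- xc) momden qK (zeta y).
  rewrite -[_ :: _]/(map fst xc) big_map; apply: eq_big_seq => y yc.
  by rewrite zE.
by [].
Qed.

Lemma AWop_chains j f : (j <= d)%N -> (forall i k, (1 <= k <= j)%N -> zinv k (a i) = a i) ->
  AWop q j a f = \sum_(c <- chains j)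
    (if c is x :: c' then chain_wt c * last_wt j (last x c') else 0) * zsteps c f.
Proof.
move=> jd aI; rewrite /AWop.
pose G c := if c is [::] then 0 else (-1) ^+ size (chain_neg c)
    * compose (@zinv F d) (chain_neg c) (coefA qK j a zvar (map fst c))
    * compose (@triangle F q d) (chain_pos c) (compose (@nabla F q d) (chain_neg c) f).
transitivity (\sum_(nu : signvec j) G (chain_of nu)).
  rewrite big_mkcond; apply: eq_bigr => nu _.
  by rewrite pos_chain neg_chain supp_chain; case: (chain_of nu).
rewrite sum_chains big_seq [RHS]big_seq; apply: eq_bigr => c /chains_ok/andP[cj uc].
case: c cj uc => [|x c] cj uc; first by rewrite mul0r.
have cd : all (fun y => 1 <= y.1 <= d)%N (x :: c).
  by apply: sub_all cj => y /andP[-> /= yj]; apply: leq_trans yj jd.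
rewrite -coefA_chain // -compose_zsteps // /G.
by rewrite [_ * compose _ _ (coefA _ _ _ _ _)]mulrC -mulrA.
Qed.

Local Notation SS := (1 + a 0 ^- 2).
Local Notation tt := ((qK * a 0 ^+ 2)^-1).

Fixpoint mom j (r : nat) : K -> K :=
  if j is i.+1 then
    stepmom qK SS (mom i 0) (mom i 1) (mom i 2) (a i.+1) (shiftm q i.+1)
      (shiftm q^-1 i.+1) (zvar i.+1) r (mom i r)
  else fun f => [:: 1; 0; tt]`_r * f.

Definition chain_mom r c : K :=
  if c is x :: c' then chain_wt c * (zeta (last x c') / a (last x c').1) ^+ r
  else [:: 1; 0; tt]`_r.

Lemma chain_mom_rcons r c y : a 0 != 0 -> chain_mom r (rcons c y) =
  (zeta y / a y.1) ^+ r / momden qK (zeta y)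
  * (1 * chain_mom 0 c + (- a y.1 * zeta y * (1 + qK)) * chain_mom 1 c
     + (qK * a y.1 ^+ 2 * zeta y ^+ 2) * chain_mom 2 c
     + (- a y.1 * zeta y * SS) * (c == [::])%:R).
Proof.
move=> a0; have -> : chain_mom r (rcons c y) = chain_wt (rcons c y) * (zeta y / a y.1) ^+ r.
  by case: c => [|x c] //=; rewrite last_rcons.
rewrite chain_wt_rcons [LHS]mulrC mulrA [RHS]mulrAC; congr (_ / _); congr (_ * _).
case: c => [|x c]; rewrite [chain_mom 0 _]/= [chain_mom 1 _]/= [chain_mom 2 _]/=.
  rewrite /link0 eqxx mulr1n; exact: (@first_link_moments K qK (a 0) (a y.1) (zeta y) qK0 a0).
by rewrite (_ : (_ == _) = false) // mulr0 addr0; apply: link_moments.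
Qed.

(** Writes the identity as a sum over chains, so that scalar terms can be merged with the moments
    chain by chain. *)
Lemma sum_chains_nil j f : \sum_(c <- chains j) (c == [::])%:R * zsteps c f = f.
Proof.
elim: j => [|j IH] /=; first by rewrite big_seq1 mul1r.
rewrite !big_cat !big_map /= IH !big1 ?addr0 // => c _; case: c => [|x c]; exact: mul0r.
Qed.

Lemma mom_chains j r f : a 0 != 0 -> mom j r f = \sum_(c <- chains j) chain_mom r c * zsteps c f.
Proof.
move=> a0; elim: j r f => [|j IH] r f; first by rewrite /= big_seq1.
have stepM_chains y g : stepM qK SS (mom j 0) (mom j 1) (mom j 2) (a j.+1) y g
    = \sum_(c <- chains j) (1 * chain_mom 0 c + (- a j.+1 * y * (1 + qK)) * chain_mom 1 c
     + (qK * a j.+1 ^+ 2 * y ^+ 2) * chain_mom 2 c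
     + (- a j.+1 * y * SS) * (c == [::])%:R) * zsteps c g.
  rewrite /stepM /abcop !IH -[X in _ + _ * X](sum_chains_nil j g) !mulr_sumr -!big_split /=.
  by apply: eq_bigr => c _; rewrite !mulrA -!mulrDl.
rewrite [LHS]/= /stepmom !stepM_chains IH /= !big_cat !big_map /= -addrA; congr (_ + _).
congr (_ + _); rewrite mulr_sumr; apply: eq_bigr => c _.
  by rewrite chain_mom_rcons // /zsteps foldr_rcons mulrA.
by rewrite chain_mom_rcons // /zsteps foldr_rcons mulrA.
Qed.

(** The subtracted constant is the contribution of the empty chain, since the sum defining the
    operator omits $\nu=0$. *)
Lemma AWop_mom j f : (j <= d)%N -> (forall i k, (1 <= k <= j)%N -> zinv k (a i) = a i) ->
  a 0 != 0 -> a j.+2 != 0 ->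
  AWop q j a f = stepT0 (mom j 0) (mom j 1) (mom j 2) (a j.+1) (a j.+2) f
    - (1 + a j.+1 ^+ 2 * tt) * f.
Proof.
move=> jd aI a0 aj2; rewrite AWop_chains // /stepT0 /abcop mul0r addr0 !mom_chains //.
rewrite -[X in _ - _ * X](sum_chains_nil j f) !mulr_sumr -!big_split -sumrB /=.
apply: eq_bigr => c _; rewrite mul_sum4; congr (_ * _).
case: c => [|x c]; rewrite [chain_mom 0 _]/= [chain_mom 1 _]/= [chain_mom 2 _]/=.
  by rewrite eqxx mulr0 addr0 !mulr1 subrr.
rewrite [(_ == _)%:R](_ : _ = 0) // mulr0 subr0.
exact: (last_link_moments (a j.+1) (zeta (last x c)) (a (last x c).1) (chain_wt (x :: c)) aj2).
Qed.
End Weights.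

(** Needed because the parameter sequences of different difference operators disagree in the entry
    replaced by the next variable. *)
Lemma mom_ext (a b : nat -> K) j r f : (forall i, (i <= j)%N -> a i = b i) ->
  mom a j r f = mom b j r f.
Proof.
elim: j r f => [|j IH] r f ab; first by rewrite /= ab.
have {}IH r' g : mom a j r' g = mom b j r' g by apply: IH => i /leqW; apply: ab.
apply: stepmom_ext => [||g|g|g|g].
- by rewrite (ab 0).
- exact: ab.
- exact: IH.
- exact: IH.
- exact: IH.
exact: IH.
Qed.

(** * The moments at all levels: relations and commutativity *)

Section Levels.
Variable al : nat -> F.
Hypothesis al0 : forall i, al i != 0.
Local Notation qK := (cst d q).
Local Notation A := (fun i => cst d (al i)).
Local Notation SS := (1 + cst d (al 0) ^- 2).
Local Notation tt := ((qK * cst d (al 0) ^+ 2)^-1).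
Local Notation mom := (mom A).

(** The scalars of level [j]. They include $z_{j+1}$ when $j<d$. *)
Definition fixedby j (g : K) := forall k, (1 <= k <= j)%N -> shiftm q k g = g.

Lemma fixedby_ok j : scalars_ok (fixedby j).
Proof.
split=> [k _|x y Hx Hy k kj|x y Hx Hy k kj|x Hx k kj].
- exact: rmorph1.
- by rewrite rmorphB /= Hx // Hy.
- by rewrite rmorphM /= Hx // Hy.
by rewrite fmorphV /= Hx.
Qed.

Lemma fixedby_cst j c : fixedby j (cst d c).
Proof. by move=> k _; apply: shiftm_cst. Qed.

Lemma fixedby_zvar j k : (j < k <= d)%N -> fixedby j (zvar k).
Proof.
case/andP=> jk kd i /andP[i0 ij]; apply: shiftm_zvar_neq.
  by rewrite (leq_trans _ jk).
by rewrite gtn_eqF // (leq_ltn_trans ij).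
Qed.

Lemma shiftm_SS c k : shiftm c k SS = SS.
Proof. by rewrite rmorphD rmorph1 fmorphV rmorphXn /= shiftm_cst. Qed.

Lemma shiftm_tt c k : shiftm c k tt = tt.
Proof. by rewrite fmorphV rmorphM rmorphXn /= !shiftm_cst. Qed.

(** An instance of [commute_stepmom] in which the commuting operator is the shift itself and the
    scalars are its fixed functions. *)
Lemma mom_shiftm j r c k f : (j < k <= d)%N -> mom j r (shiftm c k f) = shiftm c k (mom j r f).
Proof.
elim: j r f => [|j IH] r f /andP[jk kd].
  rewrite /= rmorphM /=; case: r => [|[|[|r]]] /=; rewrite ?rmorph1 ?rmorph0 ?shiftm_tt //.
  by rewrite nth_nil rmorph0.
have {}IH r' g : mom j r' (shiftm c k g) = shiftm c k (mom j r' g).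
  by apply: IH; rewrite ltnW.
have jd : (1 <= j.+1 <= d)%N by rewrite /= (leq_trans _ kd) // ltnW.
have kd' : (1 <= k <= d)%N by rewrite kd (leq_trans _ jk).
have kj : j.+1 != k by rewrite ltn_eqF.
have com c' g : shiftm c' j.+1 (shiftm c k g) = shiftm c k (shiftm c' j.+1 g) := shiftmC c' c kj jd kd' g.
have zk : shiftm c k (zvar j.+1) = zvar j.+1 :> K by rewrite shiftm_zvar_neq.
have ok : scalars_ok (fun g : K => shiftm c k g = g).
  split=> [|x y Hx Hy|x y Hx Hy|x Hx]; first exact: rmorph1.
  - by rewrite rmorphB /= Hx Hy.
  - by rewrite rmorphM /= Hx Hy.
  by rewrite fmorphV /= Hx.
rewrite /=; symmetry; apply: (commute_stepmom ok) => [|||||g|g|g|g|g|g].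
- exact: shiftm_cst.
- exact: shiftm_SS.
- exact: shiftm_cst.
- exact: zk.
- by split=> [g h|x g Hx]; rewrite ?rmorphD // rmorphM /= Hx.
- by rewrite IH.
- by rewrite IH.
- by rewrite IH.
- exact: esym (com _ _).
- exact: esym (com _ _).
by rewrite IH.
Qed.

Lemma fixedby_sub i j g : (i <= j)%N -> fixedby j g -> fixedby i g.
Proof. by move=> ij Hg k /andP[k0 ki]; apply: Hg; rewrite k0 (leq_trans ki). Qed.

Lemma fixedby_SS j : fixedby j SS.
Proof. by move=> k _; apply: shiftm_SS. Qed.

Lemma fixedby_tt j : fixedby j tt.
Proof. by move=> k _; apply: shiftm_tt. Qed.

Lemma cst_al_neq0 i : cst d (al i) != 0.
Proof. by rewrite fmorph_eq0. Qed.

Section OneLevel.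
Variable j : nat.
Hypothesis jd : (j < d)%N.

Let j1 : (1 <= j.+1 <= d)%N. Proof. by []. Qed.

Lemma shiftm_inv : cancel (shiftm q^-1 j.+1) (shiftm q j.+1 : K -> K).
Proof. by have := @shiftmK F d q^-1 j.+1 j1; rewrite invrK. Qed.

Lemma shiftm_inv_zvar : shiftm q^-1 j.+1 (zvar j.+1) = zvar j.+1 / qK.
Proof. by rewrite shiftm_zvar ?invr_eq0 // fmorphV mulrC. Qed.

Lemma fixedby_zvarS : fixedby j (zvar j.+1).
Proof. by apply: fixedby_zvar; rewrite leqnn. Qed.

Lemma level_den1 m : 1 - qK ^+ m * zvar j.+1 ^+ 2 != 0.
Proof.
have := @zvar_sqr_neq F d 1 (q ^+ m) j.+1 j1; rewrite rmorph1 rmorphXn.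
by apply; rewrite expf_neq0.
Qed.

Lemma level_den2 m : qK ^+ m - zvar j.+1 ^+ 2 != 0.
Proof.
have := @zvar_sqr_neq F d (q ^+ m) 1 j.+1 j1; rewrite rmorph1 mul1r rmorphXn.
by apply; rewrite oner_neq0.
Qed.

Lemma level_mom_shiftm c r f : shiftm c j.+1 (mom j r f) = mom j r (shiftm c j.+1 f).
Proof. by rewrite mom_shiftm // leqnn. Qed.
End OneLevel.

Lemma level_triple j : (j <= d)%N -> awtriple qK SS tt (fixedby j) (mom j 0) (mom j 1) (mom j 2).
Proof.
elim: j => [|j IH] jd.
  have lin x : slinear (fixedby 0) (fun f => x * f).
    by split=> [f g|y f _]; rewrite ?mulrDr // mulrCA.
  split; try exact: lin; move=> f /=.
  - by rewrite !mul1r mul0r mulr0.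
  - by rewrite !mul0r !mulr0.
  - by rewrite mul1r !mul0r !mulr0 !add0r.
  by rewrite mul1r !mul0r !mulr0 !add0r.
have {}IH := IH (ltnW jd); have ok := fixedby_ok j.
apply: (step_triple (fixedby_ok j) IH).
- exact: qK0.
- exact: fixedby_cst.
- exact: fixedby_SS.
- exact: cst_al_neq0.
- exact: fixedby_cst.
- exact: shiftm_inv.
- exact: shiftmK.
- exact: shiftm_zvar.
- exact: shiftm_inv_zvar.
- exact: fixedby_zvarS.
- exact: zvar_neq0.
- exact: shiftm_cst.
- exact: shiftm_cst.
- exact: shiftm_SS.
- by move=> f; apply: level_mom_shiftm.
- by move=> f; apply: level_mom_shiftm.
- by move=> f; apply: level_mom_shiftm.
- exact: level_den1.
- exact: level_den2.
move=> x Hx; split; first exact: fixedby_sub Hx.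
by apply: Hx; rewrite leqnn.
Qed.

Definition T0 j (w : K) := stepT0 (mom j 0) (mom j 1) (mom j 2) (cst d (al j.+1)) w.

Lemma T0_linear j w : (j <= d)%N -> fixedby j w -> slinear (fixedby j) (T0 j w).
Proof.
move=> jd Sw; apply: (slin_stepT0 (fixedby_ok j) (level_triple jd)) => //.
exact: fixedby_cst.
Qed.

(** At $j=i+1$ the variable $z_{i+1}$ is itself shifted, and [stepT0_stepmom] applies. Beyond that
    only other variables are added, whose shifts commute with [T0 i]. *)
Lemma T0_mom i j r f : (i < j <= d)%N -> (r < 3)%N ->
  T0 i (zvar i.+1) (mom j r f) = mom j r (T0 i (zvar i.+1) f).
Proof.
elim: j r f => [|j IH] r f; first by rewrite ltn0.
rewrite ltnS leq_eqVlt => /andP[/predU1P[<-|ij] jd] r3.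
  have := stepT0_stepmom (fixedby_ok i) (level_triple (ltnW jd)) qK0 (@fixedby_cst i q)
    (@fixedby_SS i) (cst_al_neq0 i.+1) (@fixedby_cst i (al i.+1)) (shiftm_inv jd) (@shiftmK F d q i.+1 jd)
    (@shiftm_zvar F d q i.+1 q0 jd) (shiftm_inv_zvar jd) (fixedby_zvarS jd)
    (@zvar_neq0 F d i.+1 jd) (@shiftm_cst F d q i.+1 (al i.+1)) (@shiftm_cst F d q i.+1 q) (shiftm_SS q i.+1)
    (level_mom_shiftm jd q 0) (level_mom_shiftm jd q 1) (level_mom_shiftm jd q 2)
    (level_den1 jd) (level_den2 jd) f r3.
  by case: r r3 => [|[|[|//]]] _.
have jd' := ltnW jd; have id := leq_trans ij jd'.
have [TD TZ] := T0_linear (ltnW id) (fixedby_zvarS id).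
have sub g : fixedby j g -> fixedby i g by apply: fixedby_sub; exact: ltnW.
have ij2 : (i < j <= d)%N by rewrite ij.
have TE c f' : T0 i (zvar i.+1) (shiftm c j.+1 f') = shiftm c j.+1 (T0 i (zvar i.+1) f').
  have ij3 : (i < j.+1 <= d)%N by rewrite jd ltnS ltnW.
  rewrite /T0 /stepT0 /abcop !mom_shiftm //.
  have zj : shiftm c j.+1 (zvar i.+1) = zvar i.+1 :> K by rewrite shiftm_zvar_neq // ltn_eqF.
  rewrite rmorph_op4 !(rmorphD, rmorphN, rmorphM, fmorphV, rmorph1, rmorph0, rmorphXn) /=.
  by rewrite shiftm_cst zj.
apply: (commute_stepmom (fixedby_ok j)).
- exact: fixedby_cst.
- exact: fixedby_SS.
- exact: fixedby_cst.
- exact: fixedby_zvarS.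
- by split=> [g h|x g /sub Hx]; [apply: TD | apply: TZ].
- by move=> g; apply: IH.
- by move=> g; apply: IH.
- by move=> g; apply: IH.
- by move=> g; apply: TE.
- by move=> g; apply: TE.
by move=> g; apply: IH.
Qed.

Lemma T0_comm i j w f : (i < j <= d)%N -> fixedby i w -> fixedby j w ->
  T0 i (zvar i.+1) (T0 j w f) = T0 j w (T0 i (zvar i.+1) f).
Proof.
move=> ijd Sw Swj; have /andP[ij jd] := ijd; have id := leq_trans ij jd.
apply: (commute_stepT0 (fixedby_ok i)) => [||g|g|g|//].
- exact: fixedby_cst.
- exact: (T0_linear (ltnW id) (fixedby_zvarS id)).
- exact: T0_mom.
- exact: T0_mom.
exact: T0_mom.
Qed.

(** * Partial products of Askey-Wilson polynomials as eigenfunctions *)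

Section Eigenfunctions.
Hypothesis qn1 : forall n, 1 - q ^+ n.+1 != 0.
Variable nn : nat -> nat.

Definition zlast k : K := if k == d.+1 then cst d (al d.+2) else zvar k.
Definition nsum k := (\sum_(i < k) nn i)%N.
Local Notation Q i := (qK ^+ nsum i).

Definition AWfactor i := askey_wilson qK (nn i) (zlast i.+1)
  (A i.+1 * Q i) (A i.+1 / A 0%N ^+ 2 * Q i)
  (A i.+2 / A i.+1 * zlast i.+2) (A i.+2 / A i.+1 / zlast i.+2).

Definition AWprod j := \prod_(i < j) AWfactor i.

Lemma zlast_zvar k : (k <= d)%N -> zlast k = zvar k.
Proof. by move=> kd; rewrite /zlast ltn_eqF. Qed.

Lemma zlast_neq0 k : (1 <= k <= d.+1)%N -> zlast k != 0.
Proof.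
rewrite /zlast; case: (_ =P d.+1) => [_ _|/eqP kd]; first exact: cst_al_neq0.
by case/andP=> k0; rewrite leq_eqVlt (negPf kd) => kd'; apply: zvar_neq0; rewrite k0.
Qed.

Lemma shiftm_zlast c k l : (1 <= l <= d.+1)%N -> l != k -> shiftm c k (zlast l) = zlast l.
Proof.
rewrite /zlast; case: (_ =P d.+1) => [_ _ _|/eqP ld]; first exact: shiftm_cst.
case/andP=> l0; rewrite leq_eqVlt (negPf ld) => ld' lk; apply: shiftm_zvar_neq => //.
by rewrite l0.
Qed.

Lemma zinv_zlast k l : (1 <= l <= d.+1)%N -> l != k -> zinv k (zlast l) = zlast l.
Proof.
rewrite /zlast; case: (_ =P d.+1) => [_ _ _|/eqP ld]; first exact: zinv_cst.
case/andP=> l0; rewrite leq_eqVlt (negPf ld) => ld' lk; rewrite zinv_zvar ?(negPf lk) //.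
by rewrite l0.
Qed.

Lemma shiftm_AWfactor c k i : (i < d)%N -> k != i.+1 -> k != i.+2 ->
  shiftm c k (AWfactor i) = AWfactor i.
Proof.
move=> id k1 k2.
have z1 : shiftm c k (zlast i.+1) = zlast i.+1.
  by apply: shiftm_zlast; [exact: ltnW | rewrite eq_sym].
have z2 : shiftm c k (zlast i.+2) = zlast i.+2 by apply: shiftm_zlast; rewrite // eq_sym.
have EA l : shiftm c k (A l) = A l by apply: shiftm_cst.
have EQ : shiftm c k (Q i) = Q i by rewrite -(rmorphXn (cst d)) shiftm_cst.
rewrite /AWfactor; apply: rmorph_askey_wilson_eq.
- exact: shiftm_cst.
- exact: z1.
- by rewrite rmorphM /= EA EQ.
- by rewrite !rmorphM fmorphV rmorphXn /= !EA EQ.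
- by rewrite !rmorphM fmorphV /= !EA z2.
by rewrite !rmorphM !fmorphV /= !EA z2.
Qed.

Lemma shiftm_AWprod c k j : (j <= d)%N -> (j.+1 < k)%N -> shiftm c k (AWprod j) = AWprod j.
Proof.
move=> jd jk; rewrite /AWprod rmorph_prod; apply: eq_bigr => i _; have ij := ltn_ord i.
apply: shiftm_AWfactor; first exact: leq_trans ij jd.
  by rewrite gtn_eqF // (leq_trans _ (ltnW jk)).
by rewrite gtn_eqF // (leq_trans _ jk).
Qed.

Local Notation Tp j := (stepTp qK SS (mom j 0) (mom j 1) (mom j 2) (A j.+1) (shiftm q j.+1) (zvar j.+1)).
Local Notation Tm j := (stepTm qK SS (mom j 0) (mom j 1) (mom j 2) (A j.+1) (shiftm q^-1 j.+1) (zvar j.+1)).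

Lemma nsumS j : Q j.+1 = Q j * qK ^+ nn j.
Proof. by rewrite /nsum big_ord_recr /= exprD. Qed.

Lemma AWprodS j : AWprod j.+1 = AWfactor j * AWprod j.
Proof. by rewrite /AWprod big_ord_recr /= mulrC. Qed.

Lemma fixedby_aw j n x a b c e : fixedby j x -> fixedby j a -> fixedby j b ->
  fixedby j c -> fixedby j e -> fixedby j (askey_wilson qK n x a b c e).
Proof.
move=> Hx Ha Hb Hc He k kj; apply: rmorph_askey_wilson_eq; first exact: shiftm_cst.
- exact: Hx.
- exact: Ha.
- exact: Hb.
- exact: Hc.
exact: He.
Qed.

Lemma fixedby_shiftm c j g : (j < d)%N -> fixedby j g -> fixedby j (shiftm c j.+1 g).
Proof.
move=> jd Hg k /andP[k0 kj]; have kd : (1 <= k <= d)%N by rewrite k0 (leq_trans kj) // ltnW.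
have kj1 : k != j.+1 by rewrite ltn_eqF.
have j1 : (1 <= j.+1 <= d)%N by [].
rewrite [LHS](shiftmC q c kj1 kd j1 g) /=; congr (shiftm _ _ _).
by apply: Hg; rewrite k0.
Qed.

Section EigenStep.
Variable j : nat.
Hypothesis jd : (j < d)%N.
Hypotheses (IH0 : T0 j (zvar j.+1) (AWprod j) = eigT0 tt (A j.+1) (Q j) * AWprod j)
  (IHp : Tp j (AWprod j) = eigM (A 0%N) (A j.+1) (Q j) (zvar j.+1) * AWprod j)
  (IHm : Tm j (AWprod j) = eigM (A 0%N) (A j.+1) (Q j) (zvar j.+1)^-1 * AWprod j).

Variable w : K.
Hypotheses (w0 : w != 0) (Sw : fixedby j.+1 w).

Local Notation aw := (askey_wilson qK (nn j) (zvar j.+1) (A j.+1 * Q j) (A j.+1 / A 0%N ^+ 2 * Q j)).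

Lemma fixedby_factor u v : fixedby j u -> fixedby j v -> fixedby j (aw u v).
Proof.
move=> Su Sv; have ok := fixedby_ok j.
have SA i : fixedby j (A i) by apply: fixedby_cst.
have Sq : fixedby j qK by apply: fixedby_cst.
by apply: fixedby_aw => //; first exact: fixedby_zvarS; sc_tac ok.
Qed.

Lemma qK_qn1 n : 1 - qK ^+ n.+1 != 0.
Proof. by rewrite -rmorphXn -(rmorph1 (cst d)) -rmorphB fmorph_eq0. Qed.

Lemma shiftm_Q c k i : shiftm c k (Q i) = Q i.
Proof. by rewrite -(rmorphXn (cst d)) shiftm_cst. Qed.

Let Q0 : Q j != 0. Proof. exact: (expf_neq0 (nsum j) qK0). Qed.
Let Swj : fixedby j w. Proof. exact: fixedby_sub Sw. Qed.
Let SwV : fixedby j w^-1. Proof. by apply: (scV (fixedby_ok j)). Qed.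

Lemma eigen_T0_step : let p := aw (A j.+2 / A j.+1 * w) (A j.+2 / A j.+1 / w) in
  T0 j.+1 w (p * AWprod j) = eigT0 tt (A j.+2) (Q j.+1) * (p * AWprod j).
Proof.
move=> p.
have ok := fixedby_ok j; have SA i : fixedby j (A i) by apply: fixedby_cst.
have Sp : fixedby j p by apply: fixedby_factor; sc_tac ok.
rewrite nsumS /T0 /stepT0 /abcop.
apply: (step_eigen0_aw ok  (level_triple (ltnW jd)) qK0 (@fixedby_cst j q) (@fixedby_SS j)
  (cst_al_neq0 j.+1) (SA j.+1) (shiftm_inv jd) (@shiftmK F d q j.+1 jd) (@shiftm_zvar F d q j.+1 q0 jd)
  (shiftm_inv_zvar jd) (fixedby_zvarS jd) (@zvar_neq0 F d j.+1 jd)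
  (@shiftm_cst F d q j.+1 (al j.+1)) (@shiftm_cst F d q j.+1 q) (level_den1 jd) (level_den2 jd)
  (cst_al_neq0 0) erefl erefl Q0 IHp IHm IH0).
- exact: w0.
- exact: qK_qn1.
- by apply: Sw; rewrite leqnn.
- exact: shiftm_cst.
- exact: shiftm_Q.
- exact: shiftm_cst.
- exact: Sp.
- exact: fixedby_shiftm.
exact: fixedby_shiftm.
Qed.

Lemma eigen_M_step :
  let u := A j.+2 / A j.+1 * w in let v := A j.+2 / A j.+1 / w in
  stepM qK SS (mom j.+1 0) (mom j.+1 1) (mom j.+1 2) (A j.+2) w (aw (qK * u) (v / qK) * AWprod j)
  = eigM (A 0%N) (A j.+2) (Q j.+1) w * (aw u v * AWprod j).
Proof.
move=> u v.
have ok := fixedby_ok j; have SA i : fixedby j (A i) by apply: fixedby_cst.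
have Sq : fixedby j qK by apply: fixedby_cst.
have Sp : fixedby j (aw (qK * u) (v / qK)) by apply: fixedby_factor; rewrite /u /v; sc_tac ok.
rewrite nsumS /stepM /abcop.
apply: (step_eigen1_aw ok  (level_triple (ltnW jd)) qK0 (@fixedby_cst j q) (@fixedby_SS j)
  (cst_al_neq0 j.+1) (SA j.+1) (shiftm_inv jd) (@shiftmK F d q j.+1 jd) (@shiftm_zvar F d q j.+1 q0 jd)
  (shiftm_inv_zvar jd) (fixedby_zvarS jd) (@zvar_neq0 F d j.+1 jd)
  (@shiftm_cst F d q j.+1 (al j.+1)) (@shiftm_cst F d q j.+1 q) (level_den1 jd) (level_den2 jd)
  (cst_al_neq0 0) erefl erefl Q0 IHp IHm IH0).
- exact: qK_qn1.
- by apply: Sw; rewrite leqnn.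
- exact: shiftm_cst.
- exact: shiftm_Q.
- exact: shiftm_cst.
- exact: Sp.
- exact: fixedby_shiftm.
exact: fixedby_shiftm.
Qed.
End EigenStep.

Lemma fixedby_zlast j k : (j < k <= d.+1)%N -> fixedby j (zlast k).
Proof.
case/andP=> jk kd i /andP[i0 ij]; apply: shiftm_zlast.
  by rewrite kd andbT (leq_ltn_trans _ jk).
by rewrite gtn_eqF // (leq_ltn_trans ij).
Qed.

Lemma shiftm_AWfactor_last c j : c != 0 -> (j.+1 < d)%N ->
  let u := A j.+2 / A j.+1 * zvar j.+2 in let v := A j.+2 / A j.+1 / zvar j.+2 in
  shiftm c j.+2 (AWfactor j) = askey_wilson qK (nn j) (zvar j.+1) (A j.+1 * Q j)
    (A j.+1 / A 0%N ^+ 2 * Q j) (cst d c * u) (v / cst d c).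
Proof.
move=> c0 jd u v; have jd' := ltnW jd.
have jk : j.+1 != j.+2 by rewrite ltn_eqF.
have EA i : shiftm c j.+2 (A i) = A i by apply: shiftm_cst.
have EQ : shiftm c j.+2 (Q j) = Q j by apply: shiftm_Q.
have EB : shiftm c j.+2 (A j.+2 / A j.+1) = A j.+2 / A j.+1.
  by rewrite rmorphM fmorphV /= !EA.
have Ez : shiftm c j.+2 (zvar j.+2) = cst d c * zvar j.+2 by apply: shiftm_zvar.
rewrite /AWfactor !zlast_zvar //; apply: rmorph_askey_wilson_eq.
- exact: shiftm_cst.
- exact: shiftm_zvar_neq.
- by rewrite rmorphM /= EA EQ.
- by rewrite !rmorphM fmorphV rmorphXn /= !EA EQ.
- by rewrite rmorphM /= EB Ez mulrCA.
by rewrite rmorphM fmorphV /= EB Ez invfM [(cst d c)^-1 * _]mulrC mulrA.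
Qed.

(** The two statements with shifts are what the next step consumes; they are restricted to $j<d$
    because $z_{d+1}$ is a constant and has no shift. *)
Lemma AWprod_eigen j : (j <= d)%N ->
  T0 j (zlast j.+1) (AWprod j) = eigT0 tt (A j.+1) (Q j) * AWprod j
  /\ ((j < d)%N ->
    Tp j (AWprod j) = eigM (A 0%N) (A j.+1) (Q j) (zvar j.+1) * AWprod j
    /\ Tm j (AWprod j) = eigM (A 0%N) (A j.+1) (Q j) (zvar j.+1)^-1 * AWprod j).
Proof.
elim: j => [|j IH] jd.
  rewrite /nsum /AWprod !big_ord0 expr0; split.
    by rewrite /T0 /stepT0 /abcop /eigT0 /= !(mulr1, mul1r, mulr0, mul0r, addr0, invr1).
  move=> d0; rewrite /stepTp /stepTm !rmorph1.
  split; rewrite /stepM /abcop /= mul0r !mulr1;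
    exact: (eigM_base _ _ qK0 (cst_al_neq0 0)).
have [IH0 /(_ jd)[IHp IHm]] := IH (ltnW jd).
rewrite zlast_zvar // in IH0; rewrite AWprodS; split.
  have := eigen_T0_step jd IH0 IHp IHm (zlast_neq0 _) (fixedby_zlast _).
  rewrite /AWfactor [zlast j.+1]zlast_zvar //; apply; first exact: jd.
  by rewrite leqnn.
move=> jd1; have z2 : zlast j.+2 = zvar j.+2 by rewrite zlast_zvar.
have Sw : fixedby j.+1 (zvar j.+2) by apply: fixedby_zvarS.
have SwV : fixedby j.+1 (zvar j.+2)^-1 by apply: (scV (fixedby_ok j.+1)).
have facE : AWfactor j = askey_wilson qK (nn j) (zvar j.+1) (A j.+1 * Q j)
    (A j.+1 / A 0%N ^+ 2 * Q j) (A j.+2 / A j.+1 * zvar j.+2) (A j.+2 / A j.+1 / zvar j.+2).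
  by rewrite /AWfactor z2 zlast_zvar.
split.
  rewrite /stepTp rmorphM /= shiftm_AWprod // ?(ltnW jd) // shiftm_AWfactor_last //.
  by rewrite facE; apply: eigen_M_step.
rewrite /stepTm rmorphM /= shiftm_AWprod // ?(ltnW jd) // shiftm_AWfactor_last ?invr_eq0 //.
(* For $w=z_{j+2}^{-1}$ the last two parameters come out in exchanged order; the swap restores it
   and turns $(qc,e/q)$ into $(c/q,qe)$, the effect of the backward shift. *)
have := eigen_M_step jd IH0 IHp IHm SwV; rewrite /= facE [(_^-1)^-1]invrK.
move: (askey_wilson_swap qK (nn j) (zvar j.+1) (A j.+1 * Q j) (A j.+1 / A 0%N ^+ 2 * Q j)).
move: (askey_wilson _ _ _ _ _) => aw aw_swap H.
rewrite aw_swap fmorphV invrK [_ * qK]mulrC [qK^-1 * _]mulrC.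
by rewrite [in RHS]aw_swap; apply: H.
Qed.
Definition opL j (f : K) := AWop q j (fun k => if k == j.+2 then zlast j.+1 else A k) f.

Lemma opL_T0 j f : (j <= d)%N ->
  opL j f = T0 j (zlast j.+1) f - (1 + A j.+1 ^+ 2 * tt) * f.
Proof.
move=> jd; rewrite /opL.
suff gen (a : nat -> K) : (forall i, (i <= j.+1)%N -> a i = A i) -> a j.+2 = zlast j.+1 ->
    (forall i k, (1 <= k <= j)%N -> zinv k (a i) = a i) ->
    AWop q j a f = T0 j (zlast j.+1) f - (1 + A j.+1 ^+ 2 * tt) * f.
  apply: gen => [i ij||i k /andP[k0 kj]]; first by rewrite ltn_eqF.
    by rewrite eqxx.
  case: (i == j.+2); last exact: zinv_cst.
  by apply: zinv_zlast => //; rewrite gtn_eqF.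
move=> aE a2 aI; have n0 : a 0%N != 0 by rewrite aE // cst_al_neq0.
have n2 : a j.+2 != 0 by rewrite a2; apply: zlast_neq0.
rewrite (AWop_mom f jd aI n0 n2); congr (_ - _).
  have aE' i : (i <= j)%N -> a i = A i by move=> /leqW; apply: aE.
  apply: stepT0_ext => [||g|g|g].
  - exact: aE.
  - exact: a2.
  - exact: mom_ext.
  - exact: mom_ext.
  exact: mom_ext.
by rewrite (aE 0%N) // (aE j.+1).
Qed.

Lemma opL_linear j : (j <= d)%N -> slinear (fixedby j) (opL j).
Proof.
move=> jd; have Sw : fixedby j (zlast j.+1) by apply: fixedby_zlast; rewrite leqnn.
have [D Z] := T0_linear jd Sw.
split=> [f g|x f Hx]; rewrite !opL_T0 //; first by rewrite D mulrDr opprD addrACA.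
by rewrite Z // mulrBr mulrCA.
Qed.

Lemma opL_comm i j f : (i <= d)%N -> (j <= d)%N -> opL i (opL j f) = opL j (opL i f).
Proof.
wlog ij : i j / (i <= j)%N.
  by move=> H id jd; case: (leqP i j) => [|/ltnW] h; [|symmetry]; apply: H.
move: ij; rewrite leq_eqVlt => /predU1P[-> //|ij] id jd.
have Swi : fixedby i (zlast i.+1) by apply: fixedby_zlast; rewrite leqnn.
have Swj : fixedby j (zlast j.+1) by apply: fixedby_zlast; rewrite leqnn.
have ci k : fixedby i (1 + A k ^+ 2 * tt).
  have ok := fixedby_ok i; have St := @fixedby_tt i; have Sk := @fixedby_cst i (al k); sc_tac ok.
have cj k : fixedby j (1 + A k ^+ 2 * tt).
  have ok := fixedby_ok j; have St := @fixedby_tt j; have Sk := @fixedby_cst j (al k); sc_tac ok.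
have zi : zlast i.+1 = zvar i.+1 by rewrite zlast_zvar // (leq_trans ij).
have C g : T0 i (zlast i.+1) (T0 j (zlast j.+1) g) = T0 j (zlast j.+1) (T0 i (zlast i.+1) g).
  rewrite zi; apply: T0_comm => //; first by rewrite ij.
  exact: fixedby_sub (ltnW ij) Swj.
have Tb k w x g h : slinear (fixedby k) (T0 k w) -> fixedby k x ->
    T0 k w (g - x * h) = T0 k w g - x * T0 k w h.
  by move=> [D Z] Hx; rewrite D -mulNr Z ?mulNr //; apply: (scN (fixedby_ok k)).
rewrite !opL_T0 // !Tb // ?C; try exact: T0_linear.
exact: sub_comm.
Qed.

(** The factors after the first [j] involve only $z_{j+1}$ and later variables. Their product is a
    scalar at level [j] and comes out of the operator. *)
Lemma opL_eigen j : (j <= d)%N ->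
  opL j (AWprod d) = cst d (- (1 - q ^- nsum j)
     * (1 - al j.+1 ^+ 2 / al 0 ^+ 2 * q ^ ((nsum j)%:Z - 1))) * AWprod d.
Proof.
move=> jd; have Sw : fixedby j (zlast j.+1) by apply: fixedby_zlast; rewrite leqnn.
have -> : AWprod d = (\prod_(j <= i < d) AWfactor i) * AWprod j.
  rewrite /AWprod -!(big_mkord xpredT AWfactor) mulrC -big_cat_nat //.
set B := \prod_(j <= i < d) AWfactor i.
have SB : fixedby j B.
  move=> k /andP[k0 kj]; rewrite /B rmorph_prod !big_nat; apply: eq_bigr => i /andP[ji id].
  by apply: shiftm_AWfactor => //; rewrite ltn_eqF // ltnS (leq_trans kj) // ltnW.
have [_ Z] := opL_linear jd; rewrite Z // opL_T0 //.
have [-> _] := AWprod_eigen jd.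
rewrite -mulrBl mulrCA; congr (_ * _).
exact: (eigT0_mu (cst d) _ _ q0 (al0 0)).
Qed.
End Eigenfunctions.

End Levels.

(** * Membership in the algebra of q-difference operators, and commutativity of a generated
    algebra *)

Lemma Dz_sum (I : Type) (r : seq I) (P : pred I) (T : I -> K -> K) :
  (forall i, P i -> Dz q (T i)) -> Dz q (fun f => \sum_(i <- r | P i) T i f).
Proof.
move=> HT; elim: r => [|i r IH].
  apply: (@genalg_ext _ _ _ (fun f => cst d 0 * f)).
    by move=> f; rewrite big_nil rmorph0 mul0r.
  exact: genalg_scale (genalg_id _).
apply: (@genalg_ext _ _ _ (fun f => (if P i then T i f else 0) + \sum_(i <- r | P i) T i f)).
  by move=> f; rewrite big_cons; case: (P i); rewrite ?add0r.
case: (boolP (P i)) => Pi.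
  by apply: genalg_add => //; apply: HT.
by apply: genalg_ext IH => f; rewrite add0r.
Qed.

Lemma Dz_compose (T : nat -> K -> K) s : all (fun k => 1 <= k <= d)%N s ->
  (forall k, (1 <= k <= d)%N -> Dz q (T k)) -> Dz q (compose T s).
Proof.
move=> sd HT; elim: s sd => /= [|k s IH] => [_|/andP[kd sd]]; first exact: genalg_id.
by apply: genalg_comp; [exact: HT | exact: IH].
Qed.

Lemma Dz_subid c : Dz q (fun f : K => cst d c * f).
Proof. exact: genalg_scale (genalg_id _). Qed.

Lemma Dz_triangle k : (1 <= k <= d)%N -> Dz q (@triangle F q d k).
Proof.
move=> kd; apply: (@genalg_ext _ _ _ (fun f => shift q k f + cst d (-1) * f)).
  by move=> f; rewrite rmorphN1 mulN1r.
apply: genalg_add; last exact: Dz_subid.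
by apply: genalg_gen; right; exists k; split=> //; left.
Qed.

Lemma Dz_nabla k : (1 <= k <= d)%N -> Dz q (@nabla F q d k).
Proof.
move=> kd; apply: (@genalg_ext _ _ _ (fun f => cst d 1 * f + cst d (-1) * shift q^-1 k f)).
  by move=> f; rewrite rmorphN1 mulN1r rmorph1 mul1r.
apply: genalg_add; first exact: Dz_subid.
apply: genalg_scale; apply: genalg_gen; right; exists k; split=> //; by right.
Qed.

Lemma Dz_AWop j (a : nat -> K) : (j <= d)%N -> Dz q (AWop q j a).
Proof.
move=> jd; apply: Dz_sum => nu _.
have ok (p : pred 'I_j) : all (fun k => 1 <= k <= d)%N [seq i.+1 | i : 'I_j <- enum 'I_j & p i].
  by apply/allP => k /mapP[i _ ->]; rewrite /= (leq_trans (ltn_ord i)).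
set g := _ * compose _ _ (coefA _ _ _ _ _).
apply: (@genalg_comp _ _ _ (fun f => g * f)); first by apply: genalg_gen; left; exists g.
apply: genalg_comp; apply: Dz_compose; rewrite ?ok //.
  exact: Dz_triangle.
exact: Dz_nabla.
Qed.

(** The scalars shared by all levels, over which every generator is linear. *)
Definition constant (x : K) := exists c, x = cst d c.

Lemma genalg_slinear (S : (K -> K) -> Prop) T :
  (forall A, S A -> slinear constant A) -> genalg S T -> slinear constant T.
Proof.
move=> HS; elim=> {T} [T /HS //||c T _ [D Z]|T U _ [D Z] _ [D' Z']|T U _ [D Z] _ [D' Z']|T U TU _ [D Z]].
- by split.
- by split=> [f g|x f Hx]; rewrite ?D ?mulrDr // Z // mulrCA.
- by split=> [f g|x f Hx]; rewrite ?D ?D' ?Z ?Z' ?mulrDr // addrACA.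
- by split=> [f g|x f Hx] /=; rewrite ?D' ?D ?Z' ?Z.
by split=> [f g|x f Hx]; rewrite -!TU ?D ?Z.
Qed.

Lemma genalg_commute1 (S : (K -> K) -> Prop) U T : slinear constant U ->
  (forall A, S A -> A \o U =1 U \o A) -> genalg S T -> T \o U =1 U \o T.
Proof.
move=> [D Z] HS; elim=> {T} [T /HS //|//|c T _ IH f|T V _ IH _ IH' f|T V _ IH _ IH' f|T V TV _ IH f] /=.
- by rewrite Z; [congr (_ * _); exact: IH | exists c].
- by rewrite D; congr (_ + _); [exact: IH | exact: IH'].
- exact: etrans (congr1 T (IH' f)) (IH (V f)).
by rewrite -!TV; exact: IH.
Qed.

(** [genalg_commute1] is used twice: it reduces [T] to a generator, and then, with that generator as
    the fixed operator, reduces [U] as well. *)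
Lemma genalg_commute (S : (K -> K) -> Prop) T U :
  (forall A, S A -> slinear constant A) ->
  (forall A B, S A -> S B -> A \o B =1 B \o A) ->
  genalg S T -> genalg S U -> T \o U =1 U \o T.
Proof.
move=> Slin Scom ST SU; apply: (genalg_commute1 (genalg_slinear Slin SU)) ST => A SA f.
by apply/esym; apply: (genalg_commute1 (Slin A SA)) SU f => B SB; apply: Scom.
Qed.
End Chains.

Theorem proposition4p5 (R : realType) (q : R) (d : nat)
    (alpha : 'I_d.+3 -> R[i]) :
  0 < q -> q < 1 -> (1 <= d)%N -> (forall k, alpha k != 0) ->
  [/\ forall (j : nat) (n : 'I_d -> nat), (1 <= j <= d)%N ->
        frakL q alpha j (multiAW q alpha n)
        = cst d (mu q alpha n j) * multiAW q alpha n,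
      forall i j : nat, (1 <= i <= d)%N -> (1 <= j <= d)%N ->
        frakL q alpha i \o frakL q alpha j
        =1 frakL q alpha j \o frakL q alpha i,
      forall A : ratfun R[i] d -> ratfun R[i] d,
        Az q alpha A -> Dz q%:C A
    & forall A B : ratfun R[i] d -> ratfun R[i] d,
        Az q alpha A -> Az q alpha B -> A \o B =1 B \o A].
Proof.
move=> q0 q1 d1 alpha0.
pose al k := alpha (inord k).
have al0 k : al k != 0 by apply: alpha0.
have qC0 : q%:C != 0 by rewrite fmorph_eq0 gt_eqF.
have qn1 m : 1 - q%:C ^+ m.+1 != 0.
  rewrite -rmorphXn -(rmorph1 (real_complex R)) -rmorphB fmorph_eq0 subr_eq0 eq_sym.
  by rewrite lt_eqF // exprn_ilt1 // ltW.
have linL j : (j <= d)%N -> slinear (@constant _ d) (frakL q alpha j).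
  move=> jd; have [D Z] := opL_linear qC0 al0 jd.
  by split=> // x f [c ->]; apply: Z; apply: fixedby_cst.
have comL i j : (1 <= i <= d)%N -> (1 <= j <= d)%N ->
    frakL q alpha i \o frakL q alpha j =1 frakL q alpha j \o frakL q alpha i.
  by move=> /andP[_ id] /andP[_ jd] f; apply: opL_comm.
split=> //.
- move=> j n /andP[j1 jd].
  pose nn i := if insub i is Some o then n o else 0%N.
  have nnE (i : 'I_d) : nn i = n i by rewrite /nn valK.
  have psumE k : (k <= d)%N -> psum n k = nsum nn k.
    move=> kd; rewrite /psum /nsum (big_ord_widen_cond _ predT nn kd).
    by apply: eq_bigr => i _; rewrite nnE.
  have -> : multiAW q alpha n = AWprod d q%:C al nn d.
    apply: eq_bigr => i _; have id : (i <= d)%N by apply: ltnW.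
    by rewrite /AWfactor -(psumE i id) -(nnE i).
  rewrite /mu [ord0](_ : _ = inord 0); last by apply: val_inj; rewrite /= inordK.
  by rewrite psumE //; apply: opL_eigen.
- move=> A; elim=> {A} [_ [j [/andP[_ jd] ->]]||c A _|A B _ + _|A B _ + _|A B AB _].
  + exact: Dz_AWop.
  + exact: genalg_id.
  + exact: genalg_scale.
  + exact: genalg_add.
  + exact: genalg_comp.
  exact: genalg_ext AB.
move=> A B; apply: genalg_commute => [_ [j [/andP[_ jd] ->]]|_ _ [i [id ->]] [j [jd ->]]].
  exact: linL.
exact: comL.
Qed.
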